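(* Let $\Sigma$ be a positive continuous-time semi-Markovian jump linear system such that, for some constants $T>0$ and $R>0$, one has $0<h_k\le T$ and $\|J_k\|\le R$ for every $k\ge 0$. Let $m$ be a positive integer, and let $\mathcal S\Sigma$ be the discrete-time system $$\mathcal S\Sigma:\quad x_d(k+1)=J_ke^{A_{\sigma_k}h_k}x_d(k),\quad k\ge0,\qquad x_d(0)=x_0 .$$ Then $\Sigma$ is exponentially $m$-th mean stable if and only if $\mathcal S\Sigma$ is exponentially $m$-th mean stable.
   Context: Setting. Let $A_1,\dots,A_N$ be real $n\times n$ matrices. On a probability space $(\Omega,\mathcal M,P)$ let $\{\sigma_k\}_{k\ge0}$, $\{t_k\}_{k\ge0}$, $\{J_k\}_{k\ge0}$ be stochastic processes with values in $\{1,\dots,N\}$, $\mathbb R_+$, $\mathbb R^{n\times n}$, with $\{t_k\}$ non-decreasing, $t_0=0$, $\sigma_0$ constant, and put $h_k=t_{k+1}-t_k$. The switched system $\Sigma$ is: $\frac{dx}{dt}=A_{\sigma_k}x(t)$ for $t_k\le t<t_{k+1}$, and $x(t_{k+1})=J_kx(t_{k+1}^-)$ for $k\ge0$ ($x(t^-)$ is the left limit), with constant initial state $x(0)=x_0\in\mathbb R^n$. $\Sigma$ is a continuous-time semi-Markovian jump linear system if for all $i,j\in\{1,\dots,N\}$, $t\ge0$, $k\ge 0$ and Borel $B\subset\mathbb R^{n\times n}$: (1) $P(\sigma_{k+1}=j,h_k\le t,J_k\in B\mid\sigma_k,\dots,\sigma_0,t_k,\dots,t_0,J_{k-1},\dots,J_0)=P(\sigma_{k+1}=j,h_k\le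 t,J_k\in B\mid\sigma_k)$; (2) $P(\sigma_{k+1}=j,h_k\le t,J_k\in B\mid\sigma_k=i)$ is independent of $k$. It is positive if moreover each $A_i$ is Metzler (off-diagonal entries nonnegative) and each $J_k$ is entrywise nonnegative with probability 1. When the initial mode $\sigma_0$ varies over $\{1,\dots,N\}$, the transition law in (2) (given for every $i$) is kept fixed. Stability. $\Sigma$ is exponentially $m$-th mean stable if there exist $C>0$, $\beta>0$ such that $E[\|x(t)\|^m]\le Ce^{-\beta t}\|x_0\|^m$ for all $t\ge0$, all $x_0\in\mathbb R^n$ and all $\sigma_0\in\{1,\dots,N\}$. $\mathcal S\Sigma$ is exponentially $m$-th mean stable if there exist $C>0$, $\beta>0$ such that $E[\|x_d(k)\|^m]\le Ce^{-\beta k}\|x_0\|^m$ for all integers $k\ge0$, all $x_0\in\mathbb R^n$ and all $\sigma_0$. The choice of norm is immaterial. (For the trajectory $x$ of $\Sigma$ one has $x_d(k)=x(t_k)$.) *)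

(* Defs.v *)
From HB Require Import structures.
From mathcomp Require Import all_boot all_order all_algebra.
From mathcomp Require Import all_classical all_reals all_analysis.

Set Implicit Arguments.
Unset Strict Implicit.
Unset Printing Implicit Defensive.

Import Order.TTheory GRing.Theory Num.Theory.
Import numFieldNormedType.Exports.

Local Open Scope classical_set_scope.
Local Open Scope ring_scope.

(* Matrices and column vectors carry the library's max norm `|_|. *)

Definition expmx (R : realType) (n : nat) (M : 'M[R]_n) : 'M[R]_n :=
  limn (series (fun k : nat => (k`!%:R)^-1 *: M ^+ k)).

Definition metzler (R : realType) (n : nat) (M : 'M[R]_n) : Prop :=
  forall i j : 'I_n, i != j -> 0 <= M i j.

Definition borel_mx (R : realType) (n : nat) : set (set 'M[R]_n) :=
  <<s @open 'M[R]_n >>.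

(* The modes {1, ..., N} are rendered as 'I_N. *)
Record jump_process (T : Type) (R : realType) (N n : nat) := JumpProcess {
  mode : nat -> T -> 'I_N;        (* sigma_k *)
  time : nat -> T -> R;           (* t_k *)
  jump : nat -> T -> 'M[R]_n      (* J_k *)
}.

(* h_k *)
Definition hold (T : Type) (R : realType) (N n : nat)
    (S : jump_process T R N n) (k : nat) (w : T) : R :=
  time S k.+1 w - time S k w.

Section jump_process.
Context (d : measure_display) (Omega : measurableType d) (R : realType).
Context (N n : nat).
Implicit Types (P : probability Omega R) (S : jump_process Omega R N n).

Definition is_jump_process S (i0 : 'I_N) : Prop :=
  [/\ forall k (j : 'I_N), measurable (mode S k @^-1` [set j]),
      forall k, measurable_fun setT (time S k),
      forall k B, borel_mx B -> measurable (jump S k @^-1` B),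
      forall k w, time S k w <= time S k.+1 w &
      forall w, time S 0%N w = 0 /\ mode S 0%N w = i0].

Definition mode_sigma S (k : nat) : set (set Omega) :=
  <<s preimage_set_system setT (mode S k) setT >>.

Definition history_sigma S (k : nat) : set (set Omega) :=
  <<s (\bigcup_(l in [set l | (l <= k)%N])
         preimage_set_system setT (mode S l) setT) `|`
      (\bigcup_(l in [set l | (l <= k)%N])
         preimage_set_system setT (time S l) measurable) `|`
      (\bigcup_(l in [set l | (l < k)%N])
         preimage_set_system setT (jump S l) (@borel_mx R n)) >>.

(* g is a version of the conditional probability P(E | F), for a
   sub-sigma-algebra F. *)
Definition is_cond_prob P (F : set (set Omega)) (E : set Omega)
    (g : Omega -> R) : Prop :=
  [/\ forall B : set R, measurable B -> F (g @^-1` B),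
      P.-integrable setT (EFin \o g) &
      forall D, F D -> (\int[P]_(w in D) (g w)%:E = P (E `&` D))%E].

Definition step_event S (k : nat) (j : 'I_N) (t : R) (B : set 'M[R]_n) :
    set Omega :=
  [set w | [/\ mode S k.+1 w = j, hold S k w <= t & B (jump S k w)]].

(* Equality of two conditional probabilities is almost sure equality, that is,
   the existence of a common version. *)
Definition semi_markov P S : Prop :=
  forall (k : nat) (j : 'I_N) (t : R) (B : set 'M[R]_n),
    0 <= t -> borel_mx B ->
    exists g : Omega -> R,
      is_cond_prob P (history_sigma S k) (step_event S k j t B) g /\
      is_cond_prob P (mode_sigma S k) (step_event S k j t B) g.

(* Time homogeneity: whenever P(sigma_k = i) > 0, the conditional probability
   P(sigma_(k+1) = j, h_k <= t, J_k \in B | sigma_k = i) is Q i j t B. *)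
Definition has_transition_law P S
    (Q : 'I_N -> 'I_N -> R -> set 'M[R]_n -> R) : Prop :=
  forall (k : nat) (i j : 'I_N) (t : R) (B : set 'M[R]_n),
    0 <= t -> borel_mx B ->
    (0 < P (mode S k @^-1` [set i]))%E ->
    fine (P (step_event S k j t B `&` mode S k @^-1` [set i])) /
      fine (P (mode S k @^-1` [set i])) = Q i j t B.

End jump_process.

(* One realization of the switching data for each (constant) initial mode, all
   governed by the same transition law. *)
Definition semi_markov_jump_system (d : measure_display)
    (Omega : measurableType d) (R : realType) (N n : nat)
    (P : 'I_N -> probability Omega R) (S : 'I_N -> jump_process Omega R N n)
    : Prop :=
  exists Q : 'I_N -> 'I_N -> R -> set 'M[R]_n -> R,
    forall i0 : 'I_N,
      [/\ is_jump_process (S i0) i0, semi_markov (P i0) (S i0) &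
          has_transition_law (P i0) (S i0) Q].

Definition positive_system (d : measure_display)
    (Omega : measurableType d) (R : realType) (N n : nat)
    (P : 'I_N -> probability Omega R) (A : 'I_N -> 'M[R]_n)
    (S : 'I_N -> jump_process Omega R N n) : Prop :=
  (forall i, metzler (A i)) /\
  (forall i0 k, {ae P i0, forall w, forall a b, 0 <= jump (S i0) k w a b}).

(* The switched system along one sample path.  As x is only right-continuous
   at the switching time t_k, dx/dt is a right derivative there. *)
Definition is_trajectory (R : realType) (N n : nat) (A : 'I_N -> 'M[R]_n)
    (s : nat -> 'I_N) (t : nat -> R) (J : nat -> 'M[R]_n)
    (x0 : 'cV[R]_n) (x : R -> 'cV[R]_n) : Prop :=
  [/\ x 0 = x0,
      forall k u, t k < u < t k.+1 -> is_derive u (1 : R) x (A (s k) *m x u),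
      forall k, t k < t k.+1 ->
        e^-1 *: (x (t k + e) - x (t k)) @[e --> 0^'+] --> A (s k) *m x (t k) &
      forall k, exists2 v : 'cV[R]_n,
        x u @[u --> (t k.+1)^'-] --> v & x (t k.+1) = J k *m v].

Fixpoint discretization (T : Type) (R : realType) (N n : nat)
    (A : 'I_N -> 'M[R]_n) (S : jump_process T R N n) (x0 : 'cV[R]_n)
    (k : nat) (w : T) : 'cV[R]_n :=
  if k is k'.+1 then
    jump S k' w *m expmx (hold S k' w *: A (mode S k' w)) *m
      discretization A S x0 k' w
  else x0.

(* x i0 x0 is the trajectory with initial mode i0 and initial state x0; the
   constants C and beta are uniform in both. *)
Definition exp_mean_stable (d : measure_display) (Omega : measurableType d)
    (R : realType) (N n : nat) (P : 'I_N -> probability Omega R)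
    (x : 'I_N -> 'cV[R]_n -> R -> Omega -> 'cV[R]_n) (m : nat) : Prop :=
  exists C beta : R, [/\ 0 < C, 0 < beta &
    forall (i0 : 'I_N) (x0 : 'cV[R]_n) (t : R), 0 <= t ->
      ('E_(P i0)[fun w => (`|x i0 x0 t w| ^+ m)%R] <=
         (C * expR (- beta * t) * `|x0| ^+ m)%:E)%E].

Definition discrete_exp_mean_stable (d : measure_display)
    (Omega : measurableType d) (R : realType) (N n : nat)
    (P : 'I_N -> probability Omega R)
    (x : 'I_N -> 'cV[R]_n -> nat -> Omega -> 'cV[R]_n) (m : nat) : Prop :=
  exists C beta : R, [/\ 0 < C, 0 < beta &
    forall (i0 : 'I_N) (x0 : 'cV[R]_n) (k : nat),
      ('E_(P i0)[fun w => (`|x i0 x0 k w| ^+ m)%R] <=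
         (C * expR (- beta * k%:R) * `|x0| ^+ m)%:E)%E].

(* Main.v *)
Require Import Defs.
From HB Require Import structures.
From mathcomp Require Import all_boot all_order all_algebra.
From mathcomp Require Import all_classical all_reals all_analysis.
From mathcomp Require Import measurable_realfun ring lra.

(** Switching intervals last at most [Tmax]. Hence, almost surely, the state at
    any time of an interval and the sample of the discretization at its start
    bound each other up to a constant, by means of the flow [expmx] and its
    inverse ([trajectoryE]). Expectations below are those of the [m]-th power of
    the norm.

    Stability of the discretization passes to the trajectory: the switching times
    tend to infinity ([time_unbounded]), so that a time [t] lies in an interval,
    whose index [k] satisfies [t < k.+1 * Tmax], and the expectation at time [t]
    is bounded by a tail of the geometric series that dominates the expectations
    of the samples.

    Conversely, finitely many modes being involved, there is [dl > 0] such that a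
    holding time is at least [dl] with conditional probability at least one half,
    whatever the past. A switching interval of length at least [dl] contains a
    multiple of [dl], and the expectations of the trajectory at the multiples of
    [dl] are bounded by a geometric series; therefore the expectations of the
    samples are summable.

    Exponential decay follows from a linear recursion. Given the mode, a step is
    independent of the history and has the law of the first step of the process
    started in that mode ([step_integral]). As the discretization multiplies the
    state by a nonnegative matrix at each step, the expectations of the entries
    of the [m]-th tensor power of the state, split according to the mode, evolve
    linearly ([moment_rec]). Started from the vector of ones, which up to a
    factor dominates all initial states, their sum is therefore
    submultiplicative in time ([total_moment_submul]), and a submultiplicative
    summable sequence decays exponentially ([submul_summable_exp]). *)

Set Implicit Arguments.
Unset Strict Implicit.
Unset Printing Implicit Defensive.

Import Order.TTheory GRing.Theory Num.Theory.
Import numFieldNormedType.Exports.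

Local Open Scope classical_set_scope.
Local Open Scope ring_scope.

(** * The matrix exponential *)

Section matrix_norm.
Context (R : realType).

Lemma mx_entry_le_norm (p q : nat) (M : 'M[R]_(p, q)) i j : `|M i j| <= `|M|.
Proof.
rewrite [leRHS]/Num.Def.normr/= mx_normrE.
exact: (le_bigmax _ (fun ij => `|M ij.1 ij.2|) (i, j)).
Qed.

Lemma mx_norm_le (p q : nat) (M : 'M[R]_(p, q)) (c : R) :
  0 <= c -> (forall i j, `|M i j| <= c) -> `|M| <= c.
Proof.
move=> c0 Mc; rewrite [leLHS]/Num.Def.normr/= mx_normrE bigmax_le//.
Qed.

Lemma mx_norm_le_sum (p : nat) (v : 'cV[R]_p) : `|v| <= \sum_a `|v a 0|.
Proof.
apply: mx_norm_le => [|i j]; first exact: sumr_ge0.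
by rewrite (ord1 j) (bigD1 i)//= lerDl sumr_ge0.
Qed.

(** The factor [q] is there because the max norm is not submultiplicative. *)
Lemma mulmx_norm_le (p q r : nat) (M : 'M[R]_(p, q)) (L : 'M[R]_(q, r)) :
  `|M *m L| <= q%:R * `|M| * `|L|.
Proof.
apply: mx_norm_le => [|i j]; first by rewrite !mulr_ge0.
rewrite mxE (le_trans (ler_norm_sum _ _ _))//.
apply: (@le_trans _ _ (\sum_(k < q) `|M| * `|L|)).
  by apply: ler_sum => k _; rewrite normrM ler_pM// mx_entry_le_norm.
by rewrite sumr_const card_ord -mulrA mulr_natl.
Qed.

Lemma cvg_mxP (p q : nat) (T : Type) (F : set_system T) (FF : Filter F)
    (u : T -> 'M[R]_(p, q)) (l : 'M[R]_(p, q)) :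
  u x @[x --> F] --> l <-> forall i j, u x i j @[x --> F] --> l i j.
Proof.
split=> [ul i j|ul].
  exact: (@cvg_comp _ _ _ u (fun M : 'M[R]_(p, q) => M i j) _ _ _ ul
            (@coord_continuous _ _ _ i j l)).
apply/cvgrPdist_le => /= e e0; near=> x.
apply: mx_norm_le => [|i j]; first exact: ltW.
rewrite !mxE; move: i j; near: x.
apply: filter_forall => i; apply: filter_forall => j.
exact: ((cvgrPdist_le _ _).1 (ul i j)).
Unshelve. all: by end_near. Qed.

End matrix_norm.

Lemma cvg_sumr (R : realType) (T I : Type) (F : set_system T) (FF : Filter F)
    (r : seq I) (f : I -> T -> R) (l : I -> R) :
  (forall i, f i x @[x --> F] --> l i) ->
  \sum_(i <- r) f i x @[x --> F] --> \sum_(i <- r) l i.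
Proof. by move=> fl; apply: cvg_big => //; exact: add_continuous. Qed.

Section matrix_exponential.
Context (R : realType) (n : nat).
Implicit Types A : 'M[R]_n.

Lemma expmx_power_bound A k a b : `|(A ^+ k) a b| <= (n%:R * `|A|) ^+ k.
Proof.
elim: k a b => [|k IH] a b.
  by rewrite !expr0 mxE; case: (a == b); rewrite ?normr1 ?normr0 ?lexx ?ler01.
rewrite exprS [(A * _) a b]mxE (le_trans (ler_norm_sum _ _ _))//.
apply: (@le_trans _ _ (\sum_(j < n) `|A| * (n%:R * `|A|) ^+ k)).
  by apply: ler_sum => j _; rewrite normrM ler_pM// mx_entry_le_norm.
by rewrite sumr_const card_ord -[leLHS]mulr_natl exprS mulrA.
Qed.

(** The coefficients of the power series in [u] of the entry [(a, b)] of
    [A ^+ p *m expmx (u *: A)]; the shift by [p] makes the family stable under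
    termwise differentiation. *)
Definition exp_entry A (p : nat) (a b : 'I_n) : R^nat :=
  fun k => (k`!%:R)^-1 * (A ^+ (k + p)) a b.

Lemma pseries_diffs_exp_entry A p a b :
  pseries_diffs (exp_entry A p a b) = exp_entry A p.+1 a b.
Proof.
apply/funext => k; rewrite /pseries_diffs /exp_entry factS natrM invfM.
by rewrite addSnnS !mulrA mulfV ?mul1r.
Qed.

Lemma exp_entry_le A p a b u k :
  `|exp_entry A p a b k * u ^+ k| <=
  (n%:R * `|A|) ^+ p * exp_coeff (n%:R * `|A| * `|u|) k.
Proof.
rewrite /exp_entry /exp_coeff/= !normrM normfV normr_nat normrX.
rewrite [X in _ <= _ * (X / _)]exprMn.
have -> : (n%:R * `|A|) ^+ p * ((n%:R * `|A|) ^+ k * `|u| ^+ k / k`!%:R) =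
  k`!%:R^-1 * (n%:R * `|A|) ^+ (k + p) * `|u| ^+ k by rewrite exprD; ring.
by rewrite ler_wpM2r ?exprn_ge0// ler_wpM2l ?invr_ge0// expmx_power_bound.
Qed.

Lemma normed_cvg_exp_entry A p a b u :
  cvgn [normed series (fun k => exp_entry A p a b k * u ^+ k)].
Proof.
apply: (@series_le_cvg _ _ (fun k => (n%:R * `|A|) ^+ p *
   exp_coeff (n%:R * `|A| * `|u|) k)) => [k|k|k|].
- exact: normr_ge0.
- apply: mulr_ge0; first by rewrite exprn_ge0// mulr_ge0.
  by apply: exp_coeff_ge0; rewrite !mulr_ge0.
- exact: exp_entry_le.
- exact/is_cvg_seriesZ/is_cvg_series_exp_coeff.
Qed.

Lemma cvg_exp_entry A p a b u : cvgn (pseries (exp_entry A p a b) u).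
Proof. by apply: normed_cvg; exact: normed_cvg_exp_entry. Qed.

Lemma is_derive_exp_entry A p a b u :
  is_derive u (1 : R) (fun u => limn (pseries (exp_entry A p a b) u))
    (limn (pseries (exp_entry A p.+1 a b) u)).
Proof.
rewrite -pseries_diffs_exp_entry.
apply: (@pseries_snd_diffs _ _ (`|u| + 1)); rewrite ?pseries_diffs_exp_entry;
  try exact: cvg_exp_entry.
by rewrite [ltRHS]ger0_norm ?addr_ge0// ltrDl.
Qed.

Lemma expmxE A u a b :
  expmx (u *: A) a b = limn (pseries (exp_entry A 0 a b) u).
Proof.
have powZ k : (u *: A) ^+ k = u ^+ k *: A ^+ k.
  elim: k => [|k IH]; first by rewrite !expr0 scale1r.
  rewrite !exprS IH; apply/matrixP => i j; rewrite !mxE mulr_sumr.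
  by apply: eq_bigr => l _; rewrite !mxE; ring.
have E N i j : (series (fun k : nat => (k`!%:R)^-1 *: (u *: A) ^+ k) N) i j =
    pseries (exp_entry A 0 i j) u N.
  rewrite /series/= summxE; apply: eq_bigr => k _.
  by rewrite powZ scalerA mxE /exp_entry/= addn0; ring.
have C : series (fun k : nat => (k`!%:R)^-1 *: (u *: A) ^+ k) @ \oo -->
    (\matrix_(i, j) limn (pseries (exp_entry A 0 i j) u) : 'M[R]_n).
  apply/cvg_mxP => i j; rewrite mxE.
  under eq_fun do rewrite E.
  exact: cvg_exp_entry.
by rewrite /expmx (cvg_lim _ C)// mxE.
Qed.

Let exp_entry_mull A a b u :
  limn (pseries (exp_entry A 1 a b) u) = (A *m expmx (u *: A)) a b.
Proof.
apply/cvg_lim => //; rewrite mxE.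
have -> : pseries (exp_entry A 1 a b) u =
    (fun N => \sum_c A a c * pseries (exp_entry A 0 c b) u N).
  apply/funext => N; rewrite /pseries /series/=.
  under [RHS]eq_bigr do rewrite mulr_sumr.
  rewrite exchange_big/=; apply: eq_bigr => k _.
  rewrite /exp_entry addn1 exprS [(A * _) a b]mxE mulr_sumr mulr_suml.
  by apply: eq_bigr => c _; rewrite addn0; ring.
apply: cvg_sumr => c; rewrite expmxE.
by apply: cvgM; [exact: cvg_cst|exact: cvg_exp_entry].
Qed.

Let exp_entry_mulr A a b u :
  limn (pseries (exp_entry A 1 a b) u) = (expmx (u *: A) *m A) a b.
Proof.
apply/cvg_lim => //; rewrite mxE.
have -> : pseries (exp_entry A 1 a b) u =
    (fun N => \sum_c pseries (exp_entry A 0 a c) u N * A c b).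
  apply/funext => N; rewrite /pseries /series/=.
  under [RHS]eq_bigr do rewrite mulr_suml.
  rewrite exchange_big/=; apply: eq_bigr => k _.
  rewrite /exp_entry addn1 exprSr [(_ * A) a b]mxE mulr_sumr mulr_suml.
  by apply: eq_bigr => c _; rewrite addn0; ring.
apply: cvg_sumr => c; rewrite expmxE.
by apply: cvgM; [exact: cvg_exp_entry|exact: cvg_cst].
Qed.

(** Both sides are the derivative of [u |-> expmx (u *: A)]: the factor [A] can be
    extracted from its power series on either side. *)
Lemma expmx_comm A u : A *m expmx (u *: A) = expmx (u *: A) *m A.
Proof. by apply/matrixP => a b; rewrite -exp_entry_mull exp_entry_mulr. Qed.

Lemma is_derive_expmx A u a b :
  is_derive u (1 : R) (fun u => expmx (u *: A) a b) ((A *m expmx (u *: A)) a b).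
Proof.
rewrite -exp_entry_mull; under eq_fun do rewrite expmxE.
exact: is_derive_exp_entry.
Qed.

Lemma continuous_expmx A (a b : 'I_n) :
  continuous (fun u : R => expmx (u *: A) a b).
Proof.
move=> u; have [? _] := is_derive_expmx A u a b.
exact/differentiable_continuous/derivable1_diffP.
Qed.

Lemma expmx0 A : expmx ((0 : R) *: A) = 1%:M.
Proof.
apply/matrixP => a b; rewrite expmxE; apply/cvg_lim => //.
apply/cvgrPdist_le => e e0; near=> N.
rewrite [pseries _ _ _](_ : _ = 1%:M a b) ?subrr ?normr0 ?ltW//.
rewrite -(@prednK N); last by near: N; exact: nbhs_infty_gt.
rewrite /pseries /series/= big_nat_recl//= big1 => [|k _].
  by rewrite /exp_entry !expr0 mulr1 fact0 invr1 mul1r addr0.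
by rewrite expr0n mulr0.
Unshelve. all: by end_near. Qed.

Lemma expmx_bound A (T u : R) a b :
  `|u| <= T -> `|expmx (u *: A) a b| <= expR (n%:R * `|A| * T).
Proof.
move=> uT; rewrite expmxE.
apply: le_trans; first by apply: lim_series_norm; exact: normed_cvg_exp_entry.
rewrite /=; apply: (@le_trans _ _ (expR (n%:R * `|A| * `|u|))); last first.
  by rewrite ler_expR ler_wpM2l// mulr_ge0.
apply: lim_series_le => [||k]; first exact: normed_cvg_exp_entry.
  exact: is_cvg_series_exp_coeff.
by have := exp_entry_le A 0 a b u k; rewrite expr0 mul1r.
Qed.

Lemma expmx_norm_bound A (T u : R) :
  `|u| <= T -> `|expmx (u *: A)| <= expR (n%:R * `|A| * T).
Proof.
move=> uT; apply: mx_norm_le => [|a b]; first exact: expR_ge0.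
exact: expmx_bound.
Qed.

Lemma expmx_ge0_of_ge0 A (u : R) : 0 <= u -> (forall a b, 0 <= A a b) ->
  forall a b, 0 <= expmx (u *: A) a b.
Proof.
move=> u0 A0 a b; rewrite expmxE; apply: limr_ge; first exact: cvg_exp_entry.
have pow_ge0 k : forall i j, 0 <= (A ^+ k) i j.
  elim: k => [|k IH] i j; first by rewrite expr0 mxE ler0n.
  by rewrite exprS [X in 0 <= X]mxE sumr_ge0// => l _; rewrite mulr_ge0.
near=> N; rewrite /pseries /series/= sumr_ge0// => k _.
by rewrite /exp_entry !mulr_ge0 ?invr_ge0 ?exprn_ge0.
Unshelve. all: by end_near. Qed.

End matrix_exponential.

(** * Linear differential equations *)

Lemma mulmx_col (R : pzSemiRingType) (p q r : nat) (M : 'M[R]_(p, q))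
  (L : 'M[R]_(q, r)) b : M *m col b L = col b (M *m L).
Proof. by rewrite !colE mulmxA. Qed.

Section linear_ode.
Context (R : realType) (n : nat).
Implicit Types (A : 'M[R]_n) (y : R -> 'cV[R]_n).

Let is_derive_expmxN A (u : R) a b :
  is_derive u (1 : R) (fun u => expmx (- u *: A) a b)
    (- (A *m expmx (- u *: A)) a b).
Proof.
have d1 := is_derive_expmx A (- u) a b.
have d2 : is_derive u (1 : R) (-%R : R -> R) (- 1) by exact: is_deriveNid.
by have := is_derive1_comp d1 d2; rewrite mulrN1.
Qed.

(** A solution [y] of the linear equation is transported back to its initial value
    because [expmx (- u *: A) *m y u] has derivative zero. Only right-continuity
    is assumed at the initial time, as for a trajectory at a switching time. *)
Lemma expmxN_ode A y (h : R) :
    (forall u a, 0 < u < h ->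
      is_derive u (1 : R) (fun u => y u a 0) ((A *m y u) a 0)) ->
    (forall a, y u a 0 @[u --> 0^'+] --> y 0 a 0) ->
  forall u, 0 <= u < h -> expmx (- u *: A) *m y u = y 0.
Proof.
move=> dy y0 u /andP[]; rewrite le_eqVlt => /predU1P[<- _|u0 uh].
  by rewrite oppr0 expmx0 mul1mx.
apply/matrixP => a j; rewrite (ord1 j) {j}.
pose z w := (expmx (- w *: A) *m y w) a 0.
have zE : z = fun w => \sum_(b < n) expmx (- w *: A) a b * y w b 0.
  by apply/funext => w; rewrite /z mxE.
have dz w : w \in `]0, h[ -> is_derive w (1 : R) z 0.
  rewrite in_itv/= => wh.
  rewrite zE.
  have d b : is_derive w (1 : R) (fun w => expmx (- w *: A) a b * y w b 0)
     (expmx (- w *: A) a b * (A *m y w) b 0 +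
      y w b 0 * - (A *m expmx (- w *: A)) a b).
    have d1 := is_derive_expmxN A w a b.
    have d2 := dy w b wh.
    exact: is_deriveM.
  have := is_derive_sum d.
  rewrite big_split/=.
  have -> : \sum_i expmx (- w *: A) a i * (A *m y w) i 0 =
            (expmx (- w *: A) *m (A *m y w)) a 0 by rewrite mxE.
  have -> : \sum_i y w i 0 * - (A *m expmx (- w *: A)) a i =
            - (expmx (- w *: A) *m (A *m y w)) a 0.
    rewrite mulmxA -expmx_comm mxE -sumrN; apply: eq_bigr => i _; ring.
  rewrite subrr; congr (is_derive _ _ _ _).
  by apply/funext => t; rewrite fct_sumE.
have cz w : w \in `]0, h[ -> {for w, continuous z}.
  by move=> /dz[? _]; exact/differentiable_continuous/derivable1_diffP.
have sub w : w \in `]0, u[ -> w \in `]0, h[.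
  by rewrite !in_itv/= => /andP[-> /lt_trans]; apply.
have uin : u \in `]0, h[ by rewrite in_itv/= u0 uh.
have [||c cu] := @MVT _ z (fun=> 0) 0 u u0.
- by move=> w /sub /dz.
- apply/continuous_within_itvP => //; split.
  + by move=> w /sub /cz.
  + rewrite zE.
    apply: cvg_sumr => b; apply: cvgM; last exact: y0.
    apply: (@cvg_at_right_filter _ _ (fun w => expmx (- w *: A) a b)).
    have : {for 0, continuous (fun w : R => expmx (- w *: A) a b)}.
      have [? _] := is_derive_expmxN A 0 a b.
      exact/differentiable_continuous/derivable1_diffP.
    exact.
  + by apply: cvg_at_left_filter; exact: cz.
- rewrite mul0r => /eqP; rewrite subr_eq0 => /eqP.
  by rewrite {1}/z => ->; rewrite /z oppr0 expmx0 mul1mx.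
Qed.

(** The exponential is itself a solution of the equation, so that [expmxN_ode]
    applies to its columns. *)
Lemma expmx_mulN A (u : R) : expmx (u *: A) *m expmx (- u *: A) = 1%:M.
Proof.
wlog u0 : u / 0 <= u.
  move=> W; case: (leP 0 u) => [/W//|/ltW u0].
  by apply: mulmx1C; have := W (- u); rewrite opprK oppr_ge0; apply.
apply: mulmx1C; apply/matrixP => a b.
have := @expmxN_ode A (fun u => col b (expmx (u *: A))) (u + 1).
move=> /(_ _ _ u) H.
have : expmx (- u *: A) *m col b (expmx (u *: A)) = col b (expmx (0 *: A)).
  apply: H; last by rewrite u0 ltrDl ltr01.
  - move=> w c _; rewrite mulmx_col mxE.
    under eq_fun do rewrite mxE.
    exact: is_derive_expmx.
  - move=> c; under eq_fun do rewrite mxE.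
    by rewrite mxE; apply: cvg_at_right_filter; exact: continuous_expmx.
move=> /matrixP /(_ a 0); rewrite mulmx_col !mxE expmx0 => ->.
by rewrite mxE.
Qed.

Lemma ode_expmx A y (h : R) :
    (forall u a, 0 < u < h ->
      is_derive u (1 : R) (fun u => y u a 0) ((A *m y u) a 0)) ->
    (forall a, y u a 0 @[u --> 0^'+] --> y 0 a 0) ->
  forall u, 0 <= u < h -> y u = expmx (u *: A) *m y 0.
Proof.
move=> dy y0 u uh; rewrite -(expmxN_ode dy y0 uh).
by rewrite mulmxA expmx_mulN mul1mx.
Qed.

(** Adding [c%:M] with [c := `|A|] makes a Metzler matrix nonnegative, and the
    series of a nonnegative matrix is nonnegative; by uniqueness for the linear
    equation, [expmx (u *: A)] is [expR (- c * u)] times this series. *)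
Lemma expmx_metzler_ge0 A (u : R) : metzler A -> 0 <= u ->
  forall a b, 0 <= expmx (u *: A) a b.
Proof.
move=> mA u0 a b.
pose c := `|A|; pose B := A + c%:M.
have B0 i j : 0 <= B i j.
  rewrite !mxE; have [->|ij] := eqVneq i j; last by rewrite addr0 mA.
  rewrite mulr1n -lerBlDl sub0r.
  by rewrite (le_trans _ (mx_entry_le_norm A j j))// -normrN ler_norm.
pose y w := expR (- c * w) *: col b (expmx (w *: B)).
have yE w i : y w i 0 = expR (- c * w) * expmx (w *: B) i b by rewrite !mxE.
have -> : expmx (u *: A) a b = y u a 0.
  rewrite (@ode_expmx A y (u + 1) _ _ u); last 3 first.
  - move=> w i _; under eq_fun do rewrite yE.
    have d1 := is_derive_expmx B w i b.
    have d2 : is_derive w (1 : R) (fun w => expR (- c * w)) (- c * expR (- c * w)).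
      have d3 : is_derive w (1 : R) (fun w => - c * w) (- c).
        by apply: is_derive_eq; rewrite ?scaler0 ?add0r /GRing.scale/= mulr1.
      have := is_derive1_comp (is_derive_expR (- c * w)) d3.
      by rewrite mulrC.
    have := is_deriveM d2 d1.
    congr (is_derive _ _ _ _).
    have -> : A *m y w = B *m y w - c *: y w.
      by rewrite /B mulmxDl mul_scalar_mx addrK.
    rewrite /y -!scalemxAr mulmx_col !mxE /GRing.scale/=.
    by ring.
  - move=> i; under eq_fun do rewrite yE.
    rewrite yE; apply: cvg_at_right_filter; apply: cvgM.
      apply: (@continuous_comp _ _ _ (fun w => - c * w) expR).
        by apply: cvgM; [exact: cvg_cst|exact: cvg_id].
      exact: continuous_expR.
    exact: continuous_expmx.
  - by rewrite u0 ltrDl ltr01.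
  rewrite /y mulr0 expR0 scale1r mulmx_col expmx0.
  by rewrite mulmx1 mxE.
by rewrite yE mulr_ge0 ?expR_ge0// expmx_ge0_of_ge0.
Qed.

End linear_ode.

(** * Trajectories and their discretization *)

Section trajectory.
Context (R : realType) (n : nat).
Implicit Types (x : R -> 'cV[R]_n).

Lemma is_derive_coord x (u : R) (v : 'cV[R]_n) a :
  is_derive u (1 : R) x v -> is_derive u (1 : R) (fun w => x w a 0) (v a 0).
Proof.
move=> [dx <-]; rewrite derive_mx// mxE.
by apply/derivableP; move/derivable_mxP : dx; exact.
Qed.

Context (T : Type) (N : nat) (A : 'I_N -> 'M[R]_n)
  (S : jump_process T R N n) (w : T) (x0 : 'cV[R]_n) (x : R -> 'cV[R]_n).
Hypothesis trajx : is_trajectory A (mode S ^~ w) (time S ^~ w) (jump S ^~ w) x0 x.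
Hypothesis time0 : time S 0 w = 0.
Hypothesis hold_gt0 : forall k, 0 < hold S k w.

Let time_lt k : time S k w < time S k.+1 w.
Proof. by have := hold_gt0 k; rewrite /hold subr_gt0. Qed.

(** The right derivative at the switching time provides the right-continuity that
    uniqueness for the linear equation needs at the initial time. *)
Lemma trajectory_segment k u : time S k w <= u < time S k.+1 w ->
  x u = expmx ((u - time S k w) *: A (mode S k w)) *m x (time S k w).
Proof.
case: trajx => _ dx rx _ uk.
pose y e := x (time S k w + e).
have -> : x u = y (u - time S k w) by rewrite /y addrC subrK.
have -> : x (time S k w) = y 0 by rewrite /y addr0.
apply: (@ode_expmx _ _ _ _ (hold S k w)).
- move=> e a e0h.
  have : is_derive (time S k w + e) (1 : R) x (A (mode S k w) *m y e).
    by apply: dx; rewrite ltrDl -ltrBrDl.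
  move/(is_derive_coord a) => d1.
  have d2 : is_derive e (1 : R) (fun e => time S k w + e) 1.
    by apply: is_derive_eq; rewrite add0r mulr1.
  by have := is_derive1_comp d1 d2; rewrite mulr1.
- move=> a.
  have /cvg_mxP /(_ a 0) qa := rx k (time_lt k).
  have : e * (e^-1 *: (x (time S k w + e) - x (time S k w))) a 0 + y 0 a 0
     @[e --> 0^'+] --> 0 * (A (mode S k w) *m x (time S k w)) a 0 + y 0 a 0.
    apply: cvgD; last exact: cvg_cst.
    by apply: cvgM qa; apply: cvg_at_right_filter; exact: cvg_id.
  rewrite mul0r add0r; apply: cvg_trans; apply: near_eq_cvg.
  near=> e.
  have e0 : e != 0 by rewrite gt_eqF//; near: e; exact: nbhs_right_gt.
  by rewrite !mxE mulrA mulfV// mul1r /y addr0 subrK.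
- by move: uk; rewrite /hold subr_ge0 ltrD2r.
Unshelve. all: by end_near. Qed.

Lemma trajectory_switch k : x (time S k w) = discretization A S x0 k w.
Proof.
elim: k => [|k IH]; first by rewrite time0; case: trajx.
case: (trajx) => _ _ _ /(_ k)[v xv ->]; rewrite /= -mulmxA -IH; congr (_ *m _).
apply/matrixP => a j; rewrite (ord1 j) {j}.
move/cvg_mxP : xv => /(_ a 0) xva.
apply: (cvg_unique _ xva) => //.
pose g u := expmx ((u - time S k w) *: A (mode S k w)) *m x (time S k w).
have gc : {for time S k.+1 w, continuous (fun u => g u a 0)}.
  have -> : (fun u => g u a 0) = (fun u =>
    \sum_b expmx ((u - time S k w) *: A (mode S k w)) a b * x (time S k w) b 0).
    by apply/funext => u; rewrite mxE.
  apply: cvg_sumr => b; apply: cvgM; last exact: cvg_cst.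
  apply: (cvg_comp (fun u => u - time S k w)
    (fun u => expmx (u *: A (mode S k w)) a b)).
    by apply: cvgB; [exact: cvg_id|exact: cvg_cst].
  exact: continuous_expmx.
apply: cvg_trans (cvg_at_left_filter gc); apply: near_eq_cvg.
near=> u; rewrite /g -(@trajectory_segment k u)//; apply/andP; split.
  by near: u; exact: nbhs_left_ge.
by near: u; exact: nbhs_left_lt.
Unshelve. all: by end_near. Qed.

Lemma trajectoryE k u : time S k w <= u < time S k.+1 w ->
  x u = expmx ((u - time S k w) *: A (mode S k w)) *m discretization A S x0 k w.
Proof. by move=> uk; rewrite (trajectory_segment uk) trajectory_switch. Qed.

End trajectory.

(** * Complements on the integral *)

Section integral_complements.
Local Open Scope ereal_scope.
Import HBNNSimple.
Context d (T : measurableType d) (R : realType).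
Variable mu : {measure set T -> \bar R}.

Lemma ge0_integral_mrestr (D : set T) (mD : measurable D) (f : T -> \bar R) :
  measurable_fun setT f -> (forall x, 0 <= f x) ->
  \int[mrestr mu mD]_x f x = \int[mu]_(x in D) f x.
Proof.
move=> mf f0.
rewrite (@ge0_negligible_integral _ _ _ (mrestr mu mD) setT (~` D))//; last 2 first.
- exact: measurableC.
- by rewrite /= /mrestr setICl measure0.
rewrite setTD setCK; apply: eq_measure_integral => A mA AD.
by rewrite /= /mrestr setIidl.
Qed.

(** The integral of a nonnegative function is a supremum over simple minorants,
    so that it is monotone even for non-measurable functions. This serves for the
    trajectory, whose values at a given time are only almost everywhere equal to
    a measurable function of the sample point. *)
Lemma ae_ge0_le_integral_nonmeas (f g : T -> \bar R) :
    (forall x, 0 <= f x) -> (forall x, 0 <= g x) ->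
    {ae mu, forall x, f x <= g x} ->
  \int[mu]_x f x <= \int[mu]_x g x.
Proof.
move=> f0 g0 [Z [mZ muZ subZ]].
have mZC : measurable (~` Z) by exact: measurableC.
rewrite !ge0_integralTE//.
apply: ge_ereal_sup => _ [h hf <-].
apply: (@le_trans _ _ (sintegral mu (proj_nnsfun h mZC))).
  rewrite -mrestrict -integral_nnsfun// -[X in sintegral mu X](patch_setT (fun=> 0%R)).
  rewrite -integral_nnsfun// (ge0_negligible_integral mZ)//.
  - by rewrite setTD.
  - by apply/measurable_EFinP.
  - by move=> x _; rewrite lee_fin.
apply: ereal_sup_ubound; exists (proj_nnsfun h mZC) => // x /=.
rewrite mindicE; case: (boolP (x \in ~` Z)) => [xZ|_]; last by rewrite mulr0.
rewrite mulr1 (le_trans (hf x))//; apply: contrapT => fgx.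
by move: xZ; rewrite inE; apply; exact: (subZ x fgx).
Qed.

End integral_complements.

(** * The law of one step *)

Section step_probability.
Context d (Omega : measurableType d) (R : realType) (N n : nat).
Implicit Types (P : probability Omega R) (S : jump_process Omega R N n).

(** The generators of [history_sigma]; naming them turns the history into the
    sigma-algebra of a measurable type, [historyType] below. *)
Definition history_gen S k : set (set Omega) :=
  (\bigcup_(l in [set l | (l <= k)%N])
         preimage_set_system setT (mode S l) setT) `|`
      (\bigcup_(l in [set l | (l <= k)%N])
         preimage_set_system setT (time S l) measurable) `|`
      (\bigcup_(l in [set l | (l < k)%N])
         preimage_set_system setT (jump S l) (@borel_mx R n)).

Lemma measurable_mode S i0 k (C : set 'I_N) : is_jump_process S i0 ->
  measurable (mode S k @^-1` C).
Proof.
case=> mmode _ _ _ _.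
have -> : mode S k @^-1` C = \bigcup_(j in C) mode S k @^-1` [set j].
  by apply/seteqP; split=> [w Cw|w [j Cj /= ->]//]; exists (mode S k w).
apply: fin_bigcup_measurable; first exact: finite_finset.
by move=> j _; exact: mmode.
Qed.

Lemma history_sigma_measurable S i0 k (D : set Omega) : is_jump_process S i0 ->
  history_sigma S k D -> measurable D.
Proof.
move=> jS; have [_ mtime mjump _ _] := jS.
apply: smallest_sub; first exact: sigma_algebra_measurable.
move=> _ [[]|] [l _ [B mB <-]]; rewrite setTI.
- exact: measurable_mode jS.
- by rewrite -[_ @^-1` _]setTI; exact: mtime.
- exact: mjump.
Qed.

Lemma mode_sigma_preimage S k (D : set Omega) :
  mode_sigma S k D -> exists C, D = mode S k @^-1` C.
Proof.
move=> mD.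
suff [C _ <-] : preimage_set_system setT (mode S k) setT D.
  by exists C; rewrite setTI.
move: mD; apply: smallest_sub => //.
apply: sigma_algebra_preimage; split => //.
Qed.

Lemma measurable_step_event S i0 k j t (B : set 'M[R]_n) :
  is_jump_process S i0 -> borel_mx B -> measurable (step_event S k j t B).
Proof.
move=> [mmode mtime mjump _ _] mB.
have -> : step_event S k j t B = mode S k.+1 @^-1` [set j] `&`
    (hold S k @^-1` `]-oo, t]%classic `&` jump S k @^-1` B).
  apply/seteqP; split=> w /=; rewrite in_itv/=; first by case.
  by case=> ? [].
apply: measurableI; first exact: mmode.
apply: measurableI; last exact: mjump.
rewrite -[_ @^-1` _]setTI.
have mh : measurable_fun setT (hold S k) by exact: measurable_funB.
by apply: mh.
Qed.

(** Conditionally on the current mode, the next step is independent of the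
    history, and its law is the one of the first step of the system started in
    that mode: the common version of the two conditional probabilities is
    measurable for the mode, hence constant on the event that it equals [i]. *)
Lemma step_probability P S (i0 : 'I_N) P' S' (i : 'I_N) Q :
    is_jump_process S i0 -> semi_markov P S -> has_transition_law P S Q ->
    is_jump_process S' i -> has_transition_law P' S' Q ->
  forall k j t B D, 0 <= t -> borel_mx B -> history_sigma S k D ->
  P (step_event S k j t B `&` (mode S k @^-1` [set i] `&` D)) =
  (P (mode S k @^-1` [set i] `&` D) * P' (step_event S' 0 j t B))%E.
Proof.
move=> jS sm QS jS' QS' k j t B D t0 mB FD.
have mi := measurable_mode k [set i] jS.
have mE : measurable (step_event S k j t B) := measurable_step_event k j t jS mB.
have mD : measurable D := history_sigma_measurable jS FD.
have [Pi0|Pi0] := eqVneq (P (mode S k @^-1` [set i])) 0%E.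
  have sub0 X : measurable X -> X `<=` mode S k @^-1` [set i] -> P X = 0%E.
    by move=> mX Xi; apply: subset_measure0 Pi0.
  rewrite !sub0 ?mul0e//.
  - exact: measurableI.
  - by apply: measurableI => //; exact: measurableI.
  - by move=> w [_ []].
have [g [[_ _ gF] [mg _ gM]]] := sm k j t B t0 mB.
have Pgt0 : (0 < P (mode S k @^-1` [set i]))%E by rewrite lt0e Pi0 measure_ge0.
have [w0 w0i] : exists w, mode S k w = i.
  apply: contrapT => nw; move: Pi0; rewrite (_ : _ @^-1` _ = set0).
    by rewrite measure0 eqxx.
  by apply/seteqP; split=> // w wi; apply: nw; exists w.
have gE w : mode S k w = i -> g w = g w0.
  move=> wi; have /mode_sigma_preimage [C gC] := mg [set g w0] (measurable_set1 _).
  have Cw0 : (g @^-1` [set g w0]) w0 by [].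
  have : (mode S k @^-1` C) w by rewrite /preimage/= wi -w0i; rewrite gC in Cw0.
  by rewrite -gC.
have intE X : measurable X -> X `<=` mode S k @^-1` [set i] ->
    (\int[P]_(w in X) (g w)%:E = (g w0)%:E * P X)%E.
  move=> mX Xi; rewrite -integral_cst//; apply: eq_integral => w.
  by rewrite inE => /Xi /gE ->.
have mFi : history_sigma S k (mode S k @^-1` [set i]).
  apply: sub_sigma_algebra; left; left; exists k => //=.
  by exists [set i] => //; rewrite setTI.
have mFiD : history_sigma S k (mode S k @^-1` [set i] `&` D).
  exact: (@measurableI _ (g_sigma_algebraType (history_gen S k))).
have mMi : mode_sigma S k (mode S k @^-1` [set i]).
  by apply: sub_sigma_algebra; exists [set i] => //; rewrite setTI.
have := gF _ mFiD; rewrite intE; last 2 first.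
- exact: measurableI.
- by move=> w [].
move=> <-; rewrite muleC; congr (_ * _)%E.
have := gM _ mMi; rewrite intE// => gP.
have m'i := measurable_mode 0 [set i] jS'.
have S'i : mode S' 0 @^-1` [set i] = setT.
  by apply/seteqP; split=> // w _; case: jS' => _ _ _ _ /(_ w)[].
have := QS' 0%N i j t B t0 mB; rewrite S'i probability_setT lte01 => /(_ isT).
rewrite setIT divr1 => Q'.
have := QS k i j t B t0 mB Pgt0; rewrite -gP -Q' fineM//; last exact: fin_num_measure.
rewrite mulfK; last first.
  by rewrite fine_eq0// fin_num_measure.
move=> /= ->; rewrite fineK// fin_num_measure//.
exact: measurable_step_event jS' mB.
Qed.

End step_probability.

Section finite_image_measure.
Context d d' (T : measurableType d) (T' : measurableType d') (R : realType).
Variables (mu : {finite_measure set T -> \bar R}) (U : {mfun T >-> T'}).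

(** Keyed on a bundled measurable map, so that its finiteness can be inferred. *)
Definition image_measure : set T' -> \bar R := pushforward mu U.

Let image_measure0 : image_measure set0 = 0%E.
Proof. exact: measure0. Qed.

Let image_measure_ge0 A : (0 <= image_measure A)%E.
Proof. exact: measure_ge0. Qed.

Let image_measure_sigma_additive : semi_sigma_additive image_measure.
Proof. exact: measure_semi_sigma_additive. Qed.

HB.instance Definition _ := isMeasure.Build _ _ _ image_measure
  image_measure0 image_measure_ge0 image_measure_sigma_additive.

Let image_measure_fin : fin_num_fun image_measure.
Proof.
move=> A mA; apply: fin_num_measure.
by rewrite -[_ @^-1` _]setTI; exact: measurable_funPT.
Qed.

HB.instance Definition _ :=
  Measure_isFinite.Build _ _ _ image_measure image_measure_fin.

End finite_image_measure.

Section product_law.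
Local Open Scope ereal_scope.
Context d1 d2 d3 d4 (O1 : measurableType d1) (O2 : measurableType d2)
  (T1 : measurableType d3) (T2 : measurableType d4) (R : realType).
Variables (mu mu1 : {finite_measure set O1 -> \bar R})
  (mu2 : {finite_measure set O2 -> \bar R}).
Variables (U : {mfun O1 >-> T1}) (V : {mfun O1 >-> T2}) (V' : {mfun O2 >-> T2}).

Let UV w := (U w, V w).

Let mUV : measurable_fun setT UV.
Proof. by apply/measurable_fun_pairP; split; exact: measurable_funPT. Qed.

HB.instance Definition _ := isMeasurableFun.Build _ _ _ _ UV mUV.

(** When the joint law of [(U, V)] is a product, the integral of a product
    splits; the second factor may live on another probability space. *)
Lemma ge0_integral_product_law :
    (forall A B, measurable A -> measurable B ->
      mu (U @^-1` A `&` V @^-1` B) = mu1 (U @^-1` A) * mu2 (V' @^-1` B)) ->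
  forall (g : T1 -> R) (phi : T2 -> R),
    measurable_fun setT g -> (forall x, 0 <= g x)%R ->
    measurable_fun setT phi -> (forall y, 0 <= phi y)%R ->
  \int[mu]_w (g (U w) * phi (V w))%:E =
  \int[mu1]_w (g (U w))%:E * \int[mu2]_w (phi (V' w))%:E.
Proof.
move=> prodE g phi mg g0 mphi phi0.
pose f (z : T1 * T2) : \bar R := (g z.1 * phi z.2)%:E.
have mf : measurable_fun setT f.
  apply/measurable_EFinP; apply: measurable_funM.
    exact: (measurableT_comp mg measurable_fst).
  exact: (measurableT_comp mphi measurable_snd).
have f0 z : 0 <= f z by rewrite lee_fin mulr_ge0.
have push d (O : measurableType d) d' (T : measurableType d')
    (m : {finite_measure set O -> \bar R}) (X : {mfun O >-> T}) (h : T -> \bar R) :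
    measurable_fun setT h -> (forall y, 0 <= h y) ->
    \int[image_measure m X]_y h y = \int[m]_w h (X w).
  by move=> mh h0; rewrite ge0_integral_pushforward//; exact: measurable_funPT.
have Eg : \int[mu1]_w (g (U w))%:E = \int[image_measure mu1 U]_x (g x)%:E.
  by rewrite push//; exact/measurable_EFinP.
have Ep : \int[mu2]_w (phi (V' w))%:E = \int[image_measure mu2 V']_x (phi x)%:E.
  by rewrite push//; exact/measurable_EFinP.
transitivity (\int[image_measure mu UV]_z f z); first by rewrite push.
transitivity (\int[image_measure mu1 U \x image_measure mu2 V']_z f z).
  apply: eq_measure_integral => A mA _; apply/esym.
  by apply: product_measure_unique => // B C mB mC; rewrite -prodE.
rewrite fubini_tonelli1// Eg Ep /fubini_F.
under eq_integral => x _.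
  rewrite (_ : (fun y => f (x, y)) = (fun y => (g x)%:E * (phi y)%:E)); last first.
    by apply/funext => y; rewrite -EFinM.
  rewrite ge0_integralZl_EFin//; last 2 first.
  - by move=> y _; rewrite lee_fin.
  - exact/measurable_EFinP.
  over.
rewrite ge0_integralZr//.
- exact/measurable_EFinP.
- by move=> x _; rewrite lee_fin.
- by apply: integral_ge0 => y _; rewrite lee_fin.
Qed.

End product_law.

Section step_integral.
Context d (Omega : measurableType d) (R : realType) (N n : nat).
Implicit Types (P : probability Omega R) (S : jump_process Omega R N n).

Definition borel_mxType := g_sigma_algebraType (@open 'M[R]_n).

(** A pi-system that generates the Borel sets and on which the law of a holding
    time and a jump is prescribed by the conditional probabilities. *)
Definition rays : set (set (R * borel_mxType)) :=
  [set X | exists t B, borel_mx B /\ X = `]-oo, t]%classic `*` B].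

Lemma measurable_rays : @measurable _ (R * borel_mxType)%type = <<s rays >>.
Proof.
rewrite eqEsubset; split; last first.
  apply: smallest_sub; first exact: sigma_algebra_measurable.
  by move=> _ [t [B [mB ->]]]; apply: measurableX => //; exact: measurable_itv.
rewrite measurable_prod_measurableType.
apply: smallest_sub; first exact: smallest_sigma_algebra.
move=> _ [A mA [B mB <-]].
pose T2 : measurableType _ := g_sigma_algebraType rays.
have mray t C : borel_mx C -> @measurable _ T2 (`]-oo, t]%classic `*` C).
  by move=> mC; apply: sub_sigma_algebra; exists t, C.
have mfst : @measurable_fun _ _ T2 R setT fst.
  apply: (measurability (@RGenOInfty.G R)); first exact: RGenOInfty.measurableE.
  move=> _ [_ [t ->] <-]; rewrite setTI.
  have -> : (fst : T2 -> R) @^-1` `]t, +oo[%classic =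
      ~` (`]-oo, t]%classic `*` [set: 'M[R]_n]).
    apply/seteqP; split=> [[u M]|[u M]] /=; rewrite !in_itv/= ?andbT.
      by move=> tu [ut _]; move: tu; rewrite ltNge ut.
    by move=> H; rewrite ltNge; apply/negP => ut; exact: H.
  by apply: measurableC; apply: mray; exact: (@measurableT _ borel_mxType).
have msnd : @measurable _ T2 ([set: R] `*` B).
  have -> : [set: R] `*` B = \bigcup_k (`]-oo, k%:R]%classic `*` B).
    apply/seteqP; split=> [[u M] [_ /= BM]|[u M] [k _ [_ /= BM]]//].
    exists (Num.bound `|u|) => //; split => //=; rewrite in_itv/=.
    exact: le_trans (ler_norm u) (ltW (archi_boundP (normr_ge0 u))).
  by apply: bigcupT_measurable => k; exact: mray.
have -> : A `*` B = (fst : T2 -> R) @^-1` A `&` ([set: R] `*` B).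
  by apply/seteqP; split=> [[u M] []|[u M] [? []]].
apply: (@measurableI _ T2) => //.
by rewrite -[X in measurable X]setTI; exact: mfst.
Qed.

Lemma measure_rays_unique
    (m1 : {finite_measure set (R * borel_mxType)%type -> \bar R})
    (m2 : {measure set (R * borel_mxType)%type -> \bar R}) :
  (forall t B, borel_mx B ->
    m1 (`]-oo, t]%classic `*` B) = m2 (`]-oo, t]%classic `*` B)) ->
  forall X, measurable X -> m1 X = m2 X.
Proof.
move=> m12 X mX.
apply: (measure_unique rays (fun k => `]-oo, k%:R]%classic `*` setT)) => //.
- exact: measurable_rays.
- move=> _ _ [t [B [mB ->]]] [u [C [mC ->]]].
  exists (Num.min t u), (B `&` C); split.
    exact: (@measurableI _ borel_mxType).
  apply/seteqP; split=> [[a M]|[a M]] /=; rewrite !in_itv/= le_min.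
    by move=> [[-> BM] [-> CM]].
  by move=> [/andP[-> ->] []].
- by move=> k; exists k%:R, setT; split => //; exact: (@measurableT _ borel_mxType).
- rewrite -subTset => -[u M] _.
  exists (Num.bound `|u|) => //; split => //=; rewrite in_itv/=.
  exact: le_trans (ler_norm u) (ltW (archi_boundP (normr_ge0 u))).
- by move=> A [t [B [mB ->]]]; exact: m12.
- move=> k; rewrite ltey_eq fin_num_measure//.
  by apply: measurableX; [exact: measurable_itv|exact: measurableT].
Qed.

Definition step_data S k (w : Omega) : R * borel_mxType :=
  (hold S k w, jump S k w).

Lemma measurable_hold S i0 k : is_jump_process S i0 ->
  measurable_fun setT (hold S k).
Proof. by case=> _ mtime _ _ _; exact: measurable_funB. Qed.

Lemma measurable_step_data S i0 k : is_jump_process S i0 ->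
  measurable_fun setT (step_data S k).
Proof.
move=> jS; apply/measurable_fun_pairP; split; first exact: measurable_hold jS.
by case: jS => _ _ mjump _ _ _ B mB; rewrite setTI; exact: mjump.
Qed.

(** The sample space with the sigma-algebra of the history up to step [k]:
    measurability on this type means to be determined by the past. *)
Definition historyType S k := g_sigma_algebraType (history_gen S k).

(** On the event that the modes at steps [k] and [k.+1] are [i] and [j], the joint
    law of the history and of the step data is a product: [step_probability] says
    so on rays, which suffices by the pi-lambda theorem. *)
Lemma step_integral P S (i0 : 'I_N) P' S' (i j : 'I_N) Q k
    (g : historyType S k -> R) (phi : R * borel_mxType -> R) :
    is_jump_process S i0 -> semi_markov P S -> has_transition_law P S Q ->
    is_jump_process S' i -> has_transition_law P' S' Q ->
    measurable_fun setT g -> (forall w, 0 <= g w) ->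
    measurable_fun setT phi -> (forall z, 0 <= phi z) ->
  (\int[P]_(w in mode S k @^-1` [set i] `&` mode S k.+1 @^-1` [set j])
     (g w * phi (step_data S k w))%:E =
   \int[P]_(w in mode S k @^-1` [set i]) (g w)%:E *
   \int[P']_(w in mode S' 1 @^-1` [set j]) (phi (step_data S' 0 w))%:E)%E.
Proof.
move=> jS sm QS jS' QS' mg g0 mphi phi0.
have mi : measurable (mode S k @^-1` [set i]) by exact: measurable_mode jS.
have mj : measurable (mode S k.+1 @^-1` [set j]) by exact: measurable_mode jS.
have mj' : measurable (mode S' 1 @^-1` [set j]) by exact: measurable_mode jS'.
have mij := measurableI _ _ mi mj.
pose U (w : Omega) : historyType S k := w.
have mU : measurable_fun setT U.
  by move=> _ D mD; rewrite setTI; exact: history_sigma_measurable jS mD.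
have mV := measurable_step_data k jS.
have mV' := measurable_step_data 0 jS'.
pose UM : {mfun Omega >-> historyType S k} :=
  HB.pack U (isMeasurableFun.Build _ _ _ _ _ mU).
pose VM : {mfun Omega >-> (R * borel_mxType)%type} :=
  HB.pack (step_data S k) (isMeasurableFun.Build _ _ _ _ _ mV).
pose VM' : {mfun Omega >-> (R * borel_mxType)%type} :=
  HB.pack (step_data S' 0) (isMeasurableFun.Build _ _ _ _ _ mV').
have Plty (m : probability Omega R) D : measurable D -> (m D < +oo)%E.
  by move=> mD; rewrite ltey_eq fin_num_measure.
pose mu : {finite_measure set Omega -> \bar R} := mfrestr mij (Plty P _ mij).
pose mu1 : {finite_measure set Omega -> \bar R} := mfrestr mi (Plty P _ mi).
pose mu2 : {finite_measure set Omega -> \bar R} := mfrestr mj' (Plty P' _ mj').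
have key A B : measurable A -> measurable B ->
    mu (UM @^-1` A `&` VM @^-1` B) = (mu1 (UM @^-1` A) * mu2 (VM' @^-1` B))%E.
  move=> mA mB.
  have mA' : measurable (A : set Omega) := history_sigma_measurable jS mA.
  have mAij : measurable ((A : set Omega) `&`
      (mode S k @^-1` [set i] `&` mode S k.+1 @^-1` [set j])).
    exact: measurableI.
  pose nu : {finite_measure set Omega -> \bar R} := mfrestr mAij (Plty P _ mAij).
  have c0 : 0 <= fine (mu1 (UM @^-1` A)) by rewrite fine_ge0.
  pose m2 : {measure set (R * borel_mxType)%type -> \bar R} :=
    mscale (NngNum c0) (image_measure mu2 VM').
  transitivity (image_measure nu VM B).
    rewrite /image_measure/= /pushforward /mu /nu /= /mfrestr /mrestr.
    by congr (P _); rewrite [X in X `&` _]setIC -!setIA.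
  transitivity (m2 B); last first.
    rewrite /m2 /= /mscale /= fineK// fin_num_measure//.
  apply: measure_rays_unique => // t C mC.
  rewrite /m2/= /mscale/= /image_measure /pushforward /= fineK; last first.
    exact: fin_num_measure.
  rewrite /nu /mu1 /mu2 /= /mfrestr /mrestr.
  have -> : step_data S k @^-1` (`]-oo, t]%classic `*` C) `&`
      (A `&` (mode S k @^-1` [set i] `&` mode S k.+1 @^-1` [set j])) =
      step_event S k j t C `&` (mode S k @^-1` [set i] `&` A).
    apply/seteqP; split=> w /=; rewrite in_itv/=; first by move=> [[? ?] [? []]].
    by move=> [[? ? ?] [? ?]].
  have -> : step_data S' 0 @^-1` (`]-oo, t]%classic `*` C) `&`
      mode S' 1 @^-1` [set j] = step_event S' 0 j t C.
    apply/seteqP; split=> w /=; rewrite in_itv/=; first by move=> [[? ?] ?].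
    by move=> [? ? ?].
  have [t0|t0] := leP 0 t.
    rewrite (step_probability jS sm QS jS' QS')//; congr (P _ * _)%E.
    by rewrite setIC.
  (* holding times are nonnegative, so that a negative ray is never reached *)
  have empty S0 i1 k0 : is_jump_process S0 i1 -> step_event S0 k0 j t C = set0.
    case=> _ _ _ mono _; apply/seteqP; split=> // w [_ ht _].
    have := mono k0 w; rewrite -subr_ge0 => h0.
    by move: (le_lt_trans (le_trans h0 ht) t0); rewrite ltxx.
  by rewrite (empty _ _ _ jS) (empty _ _ _ jS') set0I !measure0 mule0.
have := @ge0_integral_product_law _ _ _ _ _ _ _ _ _ mu mu1 mu2 UM VM VM' key
  g phi mg g0 mphi phi0.
have mgU : measurable_fun setT (fun w : Omega => g w) by exact: (measurableT_comp mg mU).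
have mpV : measurable_fun setT (fun w : Omega => phi (step_data S k w)).
  exact: (measurableT_comp mphi mV).
have mpV' : measurable_fun setT (fun w : Omega => phi (step_data S' 0 w)).
  exact: (measurableT_comp mphi mV').
rewrite /mu /mu1 /mu2 /= /mfrestr.
rewrite !ge0_integral_mrestr//.
- exact/measurable_EFinP.
- by move=> w; rewrite lee_fin.
- exact/measurable_EFinP.
- by apply/measurable_EFinP; exact: measurable_funM.
- by move=> w; rewrite lee_fin mulr_ge0.
Qed.

End step_integral.

(** * Measurability with respect to the history *)

Section measurability.
Context (R : realType) (N n : nat).

Lemma measurable_fun_finite_mode d (T : measurableType d) (s : T -> 'I_N)
    (F : 'I_N -> T -> R) :
    (forall i, measurable (s @^-1` [set i])) ->
    (forall i, measurable_fun setT (F i)) ->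
  measurable_fun setT (fun w => F (s w) w).
Proof.
move=> ms mF.
have -> : (fun w => F (s w) w) =
    (fun w => \sum_i \1_(s @^-1` [set i]) w * F i w).
  apply/funext => w; rewrite (bigD1 (s w))//= indicE mem_set// mul1r.
  rewrite big1 ?addr0// => i /negP iw.
  by rewrite indicE memNset ?mul0r// => /= wi; apply: iw; rewrite wi.
by apply: measurable_sum => i; apply: measurable_funM => //.
Qed.

Lemma measurable_mx_entry a b :
  measurable_fun setT ((fun M => M a b) : borel_mxType R n -> R).
Proof.
apply: (measurability (@RGenOpens.G R)); first exact: RGenOpens.measurableE.
move=> _ [_ [x [y ->]] <-]; rewrite setTI; apply: sub_sigma_algebra.
move: (@interval_open R (BRight x) (BLeft y) isT isT).
by apply: open_comp => M _; exact: coord_continuous.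
Qed.

Variable A : 'I_N -> 'M[R]_n.

(** A function of the holding time and the jump alone, as [step_integral] asks. *)
Definition step_entry i (a b : 'I_n) (z : R * borel_mxType R n) : R :=
  ((z.2 : 'M[R]_n) *m expmx (z.1 *: A i)) a b.

Lemma measurable_expmx i a b :
  measurable_fun setT (fun u : R => expmx (u *: A i) a b).
Proof. by apply: continuous_measurable_fun; exact: continuous_expmx. Qed.

Lemma measurable_step_entry i a b : measurable_fun setT (step_entry i a b).
Proof.
have -> : step_entry i a b = (fun z => \sum_c z.2 a c * expmx (z.1 *: A i) c b).
  by apply/funext => z; rewrite /step_entry mxE.
apply: measurable_sum => c; apply: measurable_funM.
  exact: (measurableT_comp (measurable_mx_entry a c) measurable_snd).
exact: (measurableT_comp (measurable_expmx i c b) measurable_fst).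
Qed.

Context d (Omega : measurableType d).
Implicit Types (P : probability Omega R) (S : jump_process Omega R N n).

Lemma history_sigma_le S k l (D : set Omega) : (k <= l)%N ->
  history_sigma S k D -> history_sigma S l D.
Proof.
move=> kl; apply: smallest_sub; first exact: smallest_sigma_algebra.
move=> X [[]|] [h hk Xh]; apply: sub_sigma_algebra.
- by left; left; exists h => //=; exact: leq_trans hk kl.
- by left; right; exists h => //=; exact: leq_trans hk kl.
- by right; exists h => //=; exact: leq_trans hk kl.
Qed.

Lemma measurable_history_le S k l (f : Omega -> R) : (k <= l)%N ->
  @measurable_fun _ _ (historyType S k) R setT f ->
  @measurable_fun _ _ (historyType S l) R setT f.
Proof.
move=> kl mf _ B mB.
by apply: history_sigma_le kl _; exact: mf.
Qed.

Lemma measurable_history S i0 k (f : Omega -> R) : is_jump_process S i0 ->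
  @measurable_fun _ _ (historyType S k) R setT f -> measurable_fun setT f.
Proof.
move=> jS mf _ B mB; apply: history_sigma_measurable jS _.
exact: mf.
Qed.

Lemma measurable_mode_history S k l (C : set 'I_N) : (l <= k)%N ->
  @measurable _ (historyType S k) (mode S l @^-1` C).
Proof.
move=> lk; apply: sub_sigma_algebra; left; left; exists l => //.
by exists C => //; rewrite setTI.
Qed.

Lemma measurable_time_history S k l : (l <= k)%N ->
  @measurable_fun _ _ (historyType S k) R setT (time S l).
Proof.
move=> lk _ B mB; apply: sub_sigma_algebra; left; right; exists l => //.
by exists B.
Qed.

Lemma measurable_jump_history S k l a b : (l < k)%N ->
  @measurable_fun _ _ (historyType S k) R setT (fun w => jump S l w a b).
Proof.
move=> lk _ B mB; rewrite setTI; apply: sub_sigma_algebra; right; exists l => //.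
exists ((fun M : 'M[R]_n => M a b) @^-1` B); last by rewrite setTI.
by have := measurable_mx_entry a b measurableT mB; rewrite setTI.
Qed.

Lemma measurable_discretization_history S x0 k a :
  @measurable_fun _ _ (historyType S k) R setT
    (fun w => discretization A S x0 k w a 0).
Proof.
elim: k a => [|k IH] a /=; first exact: measurable_cst.
have mh : @measurable_fun _ _ (historyType S k.+1) R setT (hold S k).
  by apply: measurable_funB; apply: measurable_time_history.
pose F i (w : historyType S k.+1) := \sum_b (\sum_c jump S k w a c *
  expmx (hold S k w *: A i) c b) * discretization A S x0 k w b 0.
rewrite [X in measurable_fun _ X](_ : _ = (fun w => F (mode S k w) w)); last first.
  by apply/funext => w; rewrite mxE; apply: eq_bigr => b _; rewrite mxE.
apply: measurable_fun_finite_mode => [i|i].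
  exact: measurable_mode_history.
apply: measurable_sum => b; apply: measurable_funM; last first.
  exact: measurable_history_le (IH b).
apply: measurable_sum => c; apply: measurable_funM.
  exact: measurable_jump_history.
exact: (measurableT_comp (measurable_expmx i c b) mh).
Qed.

Lemma measurable_discretization S i0 x0 k a : is_jump_process S i0 ->
  measurable_fun setT (fun w => discretization A S x0 k w a 0).
Proof.
move=> jS; apply: (@measurable_history S i0 k) => //.
exact: measurable_discretization_history.
Qed.

Lemma ge0_integral_mode P S i0 k (D : set Omega) (f : Omega -> R) :
    is_jump_process S i0 -> measurable D ->
    measurable_fun setT f -> (forall w, 0 <= f w) ->
  (\int[P]_(w in D) (f w)%:E =
   \sum_j \int[P]_(w in D `&` mode S k @^-1` [set j]) (f w)%:E)%E.
Proof.
move=> jS mD mf f0.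
have DE : D = \big[setU/set0]_(j : 'I_N) (D `&` mode S k @^-1` [set j]).
  apply/seteqP; split=> [w Dw|w].
    by rewrite -bigcup_seq; exists (mode S k w) => //=; rewrite mem_index_enum.
  by rewrite -bigcup_seq => -[j _ []].
rewrite {1}DE ge0_integral_bigsetU//.
- by move=> j; apply: measurableI => //; exact: measurable_mode jS.
- exact: index_enum_uniq.
- by move=> i j _ _ [w [[_ /= <-] [_ /= <-]]].
- exact/measurable_EFinP/measurable_funTS.
- by move=> w _; rewrite lee_fin.
Qed.

(** [step_integral] summed over the next mode. *)
Lemma step_integralT P S (i0 : 'I_N) P' S' (i : 'I_N) Q k
    (g : historyType S k -> R) (phi : R * borel_mxType R n -> R) :
    is_jump_process S i0 -> semi_markov P S -> has_transition_law P S Q ->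
    is_jump_process S' i -> has_transition_law P' S' Q ->
    measurable_fun setT g -> (forall w, 0 <= g w) ->
    measurable_fun setT phi -> (forall z, 0 <= phi z) ->
  (\int[P]_(w in mode S k @^-1` [set i]) (g w * phi (step_data S k w))%:E =
   \int[P]_(w in mode S k @^-1` [set i]) (g w)%:E *
   \int[P']_w (phi (step_data S' 0 w))%:E)%E.
Proof.
move=> jS sm QS jS' QS' mg g0 mphi phi0.
rewrite [LHS](@ge0_integral_mode P S i0 k.+1)//; last 3 first.
- exact: measurable_mode jS.
- apply: measurable_funM; first exact: measurable_history jS mg.
  exact: (measurableT_comp mphi (measurable_step_data k jS)).
- by move=> w; rewrite mulr_ge0.
rewrite [X in (_ * X)%E](@ge0_integral_mode P' S' i 1)//; last first.
  exact: (measurableT_comp mphi (measurable_step_data 0 jS')).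
rewrite ge0_sume_distrr; last by move=> j _; apply: integral_ge0 => w _; rewrite lee_fin.
apply: eq_bigr => j _; rewrite setTI.
exact: (step_integral j jS sm QS jS' QS').
Qed.

End measurability.

(** * Moments of the discretization *)

Section moments.
Context (R : realType) (d : measure_display) (Omega : measurableType d)
  (N n : nat) (P : 'I_N -> probability Omega R) (A : 'I_N -> 'M[R]_n)
  (S : 'I_N -> jump_process Omega R N n).
Hypothesis hS : semi_markov_jump_system P S.
Hypothesis hpos : positive_system P A S.
Hypothesis hold_gt0 : forall i0, {ae P i0, forall w k, 0 < hold (S i0) k w}.

Let jS i0 : is_jump_process (S i0) i0.
Proof. by case: hS => Q /(_ i0)[]. Qed.

(** All the initial modes share the transition law, so that the step taken from
    mode [i] by any of the processes has the law of the first step of the process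
    started in mode [i]. *)
Lemma system_step i0 i k (g : historyType (S i0) k -> R)
    (phi : R * borel_mxType R n -> R) :
    measurable_fun setT g -> (forall w, 0 <= g w) ->
    measurable_fun setT phi -> (forall z, 0 <= phi z) ->
  (\int[P i0]_(w in mode (S i0) k @^-1` [set i])
      (g w * phi (step_data (S i0) k w))%:E =
   \int[P i0]_(w in mode (S i0) k @^-1` [set i]) (g w)%:E *
   \int[P i]_w (phi (step_data (S i) 0 w))%:E)%E.
Proof.
case: hS => Q HQ; have [j0 s0 q0] := HQ i0; have [j1 s1 q1] := HQ i.
by move=> *; apply: (step_integralT j0 s0 q0 j1 q1).
Qed.

Lemma system_step_mode i0 i j k (g : historyType (S i0) k -> R)
    (phi : R * borel_mxType R n -> R) :
    measurable_fun setT g -> (forall w, 0 <= g w) ->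
    measurable_fun setT phi -> (forall z, 0 <= phi z) ->
  (\int[P i0]_(w in mode (S i0) k @^-1` [set i] `&` mode (S i0) k.+1 @^-1` [set j])
     (g w * phi (step_data (S i0) k w))%:E =
   \int[P i0]_(w in mode (S i0) k @^-1` [set i]) (g w)%:E *
   \int[P i]_(w in mode (S i) 1 @^-1` [set j]) (phi (step_data (S i) 0 w))%:E)%E.
Proof.
case: hS => Q HQ; have [j0 s0 q0] := HQ i0; have [j1 s1 q1] := HQ i.
by move=> *; apply: (step_integral j j0 s0 q0 j1 q1).
Qed.

Lemma step_entry_ge0 i0 : {ae P i0, forall w k a b,
  0 <= step_entry A (mode (S i0) k w) a b (step_data (S i0) k w)}.
Proof.
have [mA J0] := hpos.
have J0' := ae_foralln (J0 i0).
apply: filterS2 (hold_gt0 i0) J0' => w h0 Jw k a b.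
rewrite /step_entry mxE sumr_ge0// => c _; rewrite mulr_ge0//; first exact: Jw.
by apply: expmx_metzler_ge0; [exact: mA|exact/ltW/h0].
Qed.

Lemma discretizationS i0 (x0 : 'cV[R]_n) k w a :
  discretization A (S i0) x0 k.+1 w a 0 =
  \sum_b step_entry A (mode (S i0) k w) a b (step_data (S i0) k w) *
    discretization A (S i0) x0 k w b 0.
Proof. by rewrite /= mxE. Qed.

Lemma discretization_ge0 i0 (x0 : 'cV[R]_n) : (forall a, 0 <= x0 a 0) ->
  {ae P i0, forall w k a, 0 <= discretization A (S i0) x0 k w a 0}.
Proof.
move=> x00; apply: filterS (step_entry_ge0 i0) => w s0.
elim=> [|k IH] a; first exact: x00.
by rewrite discretizationS sumr_ge0// => b _; rewrite mulr_ge0.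
Qed.

(** By positivity the discretization is monotone in its initial state, and
    [`|x0|] times the vector of ones dominates the entries of [x0]. *)
Lemma discretization_dominated i0 (x0 : 'cV[R]_n) : {ae P i0, forall w k,
  `|discretization A (S i0) x0 k w| <=
  `|x0| * \sum_a `|discretization A (S i0) (const_mx 1) k w a 0|}.
Proof.
have ones : forall a : 'I_n, 0 <= (const_mx 1 : 'cV[R]_n) a 0.
  by move=> a; rewrite mxE.
apply: filterS2 (step_entry_ge0 i0) (discretization_ge0 i0 ones) => w s0 d0 k.
have dom a : `|discretization A (S i0) x0 k w a 0| <=
    `|x0| * discretization A (S i0) (const_mx 1) k w a 0.
  elim: k a => [|k IH] a.
    by rewrite /= mxE mulr1 mx_entry_le_norm.
  rewrite !discretizationS mulr_sumr (le_trans (ler_norm_sum _ _ _))//.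
  apply: ler_sum => b _; rewrite normrM (ger0_norm (s0 _ _ _)) mulrCA.
  exact: ler_wpM2l.
apply: (le_trans (mx_norm_le_sum _)); rewrite mulr_sumr.
by apply: ler_sum => a _; rewrite (le_trans (dom a))// ler_wpM2l// ler_norm.
Qed.

Variable m : nat.

Let X i0 k w a := discretization A (S i0) (const_mx 1) k w a 0.

(** Up to signs, the integrand is the entry [c.2] of the [m]-th tensor power of
    the state. *)
Definition moment i0 k (c : 'I_N * {ffun 'I_m -> 'I_n}) : \bar R :=
  (\int[P i0]_(w in mode (S i0) k @^-1` [set c.1])
     (\prod_s `|X i0 k w (c.2 s)|)%:E)%E.

(** Up to signs, the integrand is the entry [(c'.2, c.2)] of the [m]-th tensor
    power of the matrix of the first step from the mode [c.1]. *)
Definition moment_matrix (c' c : 'I_N * {ffun 'I_m -> 'I_n}) : \bar R :=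
  (\int[P c.1]_(w in mode (S c.1) 1 @^-1` [set c'.1])
     (\prod_s `|step_entry A c.1 (c'.2 s) (c.2 s) (step_data (S c.1) 0 w)|)%:E)%E.

Lemma moment_ge0 i0 k c : (0 <= moment i0 k c)%E.
Proof. by apply: integral_ge0 => w _; rewrite lee_fin prodr_ge0. Qed.

Lemma moment_matrix_ge0 c' c : (0 <= moment_matrix c' c)%E.
Proof. by apply: integral_ge0 => w _; rewrite lee_fin prodr_ge0. Qed.

Let measurable_X i0 k a : measurable_fun setT (fun w => X i0 k w a).
Proof. exact: measurable_discretization (jS i0). Qed.

Let measurable_tensor i0 k (al : {ffun 'I_m -> 'I_n}) :
  measurable_fun setT (fun w => \prod_s `|X i0 k w (al s)|).
Proof.
apply: measurable_prod => s _.
exact: (measurableT_comp (@normr_measurable _ _) (measurable_X _ _ _)).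
Qed.

(** The [m]-th tensor power of the state is multiplied at each step by the tensor
    power of the step matrix, which is independent of the past given the mode, so
    that the moments evolve linearly. Positivity allows the absolute values to be
    taken entrywise. *)
Lemma moment_rec i0 k c' :
  moment i0 k.+1 c' = (\sum_c moment i0 k c * moment_matrix c' c)%E.
Proof.
case: c' => j al; rewrite /moment/=.
rewrite (@ge0_integral_mode _ _ _ _ _ (P i0) (S i0) i0 k)//; last 2 first.
- exact: measurable_mode (jS i0).
- by move=> w; rewrite prodr_ge0.
transitivity (\sum_i \sum_(be : {ffun 'I_m -> 'I_n})
    (moment i0 k (i, be) * moment_matrix (j, al) (i, be)))%E; last first.
  by rewrite pair_bigA; apply: eq_bigr => -[i be].
apply: eq_bigr => i _; rewrite setIC.
set D := _ `&` _.
have mD : measurable D.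
  by apply: measurableI; exact: measurable_mode (jS i0).
pose phi (be : {ffun 'I_m -> 'I_n}) z := \prod_s `|step_entry A i (al s) (be s) z|.
have mphi be : measurable_fun setT (phi be).
  apply: measurable_prod => s _.
  exact: (measurableT_comp (@normr_measurable _ _) (measurable_step_entry A i _ _)).
have phi0 be z : 0 <= phi be z by rewrite prodr_ge0.
have mphik be : measurable_fun setT (fun w => phi be (step_data (S i0) k w)).
  exact: (measurableT_comp (mphi be) (measurable_step_data k (jS i0))).
transitivity (\int[P i0]_(w in D) (\sum_(be : {ffun 'I_m -> 'I_n})
   (\prod_s `|X i0 k w (be s)| * phi be (step_data (S i0) k w))%:E))%E.
  apply: ge0_ae_eq_integral => //.
  - exact/measurable_EFinP/measurable_funTS.
  - apply: emeasurable_sum => be.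
    by apply/measurable_EFinP/measurable_funTS; exact: measurable_funM.
  - by move=> w _; rewrite lee_fin prodr_ge0.
  - by move=> w _; apply: sume_ge0 => be _; rewrite lee_fin mulr_ge0 ?prodr_ge0.
  have ones : forall a : 'I_n, 0 <= (const_mx 1 : 'cV[R]_n) a 0.
    by move=> a; rewrite mxE.
  apply: filterS2 (step_entry_ge0 i0) (discretization_ge0 i0 ones) => w s0 d0.
  move=> [/= wi _]; rewrite sumEFin; congr (_%:E).
  under eq_bigr => s _.
    rewrite /X discretizationS ger0_norm; last first.
      by rewrite sumr_ge0// => b _; rewrite mulr_ge0.
    over.
  rewrite bigA_distr_bigA/=; apply: eq_bigr => be _.
  rewrite /phi -big_split/=; apply: eq_bigr => s _.
  by rewrite mulrC -wi /X !ger0_norm.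
rewrite ge0_integral_sum//; last 2 first.
- by move=> be; apply/measurable_EFinP/measurable_funTS; exact: measurable_funM.
- by move=> be w _; rewrite lee_fin mulr_ge0 ?prodr_ge0.
apply: eq_bigr => be _.
rewrite (@system_step_mode i0 i j k (fun w => \prod_s `|X i0 k w (be s)|) (phi be))//.
- apply: measurable_prod => s _.
  apply: (@measurableT_comp _ _ _ (historyType (S i0) k) R R).
    exact: normr_measurable.
  exact: measurable_discretization_history.
- by move=> w; rewrite prodr_ge0.
Qed.

Definition total_moment k i0 : \bar R := (\sum_c moment i0 k c)%E.

Lemma total_momentE k i0 :
  total_moment k i0 = (\int[P i0]_w ((\sum_a `|X i0 k w a|) ^+ m)%:E)%E.
Proof.
have E w : ((\sum_a `|X i0 k w a|) ^+ m)%:E =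
    (\sum_(al : {ffun 'I_m -> 'I_n}) (\prod_s `|X i0 k w (al s)|)%:E)%E.
  rewrite sumEFin -(bigA_distr_bigA (fun _ a => `|X i0 k w a|)).
  by rewrite prodr_const card_ord.
under eq_integral do rewrite E.
rewrite ge0_integral_sum//; last 2 first.
- by move=> al; apply/measurable_EFinP.
- by move=> al w _; rewrite lee_fin prodr_ge0.
rewrite /total_moment.
transitivity (\sum_(j < N) \sum_(al : {ffun 'I_m -> 'I_n}) moment i0 k (j, al))%E.
  by rewrite pair_bigA; apply: eq_bigr => -[].
rewrite exchange_big; apply: eq_bigr => al _.
rewrite (@ge0_integral_mode _ _ _ _ _ (P i0) (S i0) i0 k)//; last first.
  by move=> w; rewrite prodr_ge0.
by apply: eq_bigr => j _; rewrite setTI.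
Qed.

Lemma total_moment_ge0 k i0 : (0 <= total_moment k i0)%E.
Proof. by apply: sume_ge0 => c _; exact: moment_ge0. Qed.

Lemma moment0 i0 c : moment i0 0 c = (if c.1 == i0 then 1 else 0)%E.
Proof.
have S0 w : mode (S i0) 0 w = i0 by case: (jS i0) => _ _ _ _ /(_ w)[].
rewrite /moment/=; have [ci|ci] := eqVneq c.1 i0.
  rewrite (_ : _ @^-1` _ = setT); last first.
    by apply/seteqP; split=> // w _ /=; rewrite S0.
  under eq_integral => w _.
    rewrite (eq_bigr (fun=> 1)); last by move=> s _; rewrite /X /= mxE normr1.
    rewrite big1_eq; over.
  by rewrite integral_cst//= mul1e probability_setT.
rewrite (_ : _ @^-1` _ = set0) ?integral_set0//.
by apply/seteqP; split=> // w /=; rewrite S0 => i0c; rewrite i0c eqxx in ci.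
Qed.

(** After [l] more steps the total moment is a linear form in the current moments.
    Its coefficient at [(j, al)] is at most the total moment after [l] steps from
    the mode [j], because every entry of the initial tensor power is one. *)
Lemma total_moment_submul k l i0 :
  (total_moment (k + l) i0 <= (\sum_i total_moment l i) * total_moment k i0)%E.
Proof.
(* the coefficients of the linear form that maps moments to totals l steps later *)
pose coef := fix coef l (c : 'I_N * {ffun 'I_m -> 'I_n}) : \bar R :=
  if l is l'.+1 then (\sum_c' coef l' c' * moment_matrix c' c)%E else 1%E.
have coef_ge0 l' c : (0 <= coef l' c)%E.
  elim: l' c => [|l' IH] c //=; apply: sume_ge0 => c' _.
  by rewrite mule_ge0// moment_matrix_ge0.
have coefE l' i k' : (\sum_c coef l' c * moment i k' c = total_moment (k' + l') i)%E.
  elim: l' k' => [|l' IH] k'.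
    by rewrite addn0; apply: eq_bigr => c _; rewrite mul1e.
  rewrite addnS -addSn -IH.
  under [RHS]eq_bigr => c _.
    rewrite moment_rec ge0_sume_distrr; last first.
      by move=> c' _; rewrite mule_ge0 ?moment_ge0 ?moment_matrix_ge0.
    over.
  rewrite exchange_big/=; apply: eq_bigr => c _.
  rewrite ge0_sume_distrl; last first.
    by move=> c' _; rewrite mule_ge0 ?moment_matrix_ge0.
  by apply: eq_bigr => c' _; rewrite -muleA [X in (_ * X)%E]muleC.
have coef_le c : (coef l c <= \sum_i total_moment l i)%E.
  case: c => j al.
  apply: (@le_trans _ _ (total_moment l j)).
    rewrite -[l]add0n -coefE (bigD1 (j, al))//= moment0/= eqxx mule1 add0n.
    rewrite leeDl//; apply: sume_ge0 => c _.
    by rewrite mule_ge0// moment_ge0.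
  rewrite (bigD1 j)//= leeDl//; apply: sume_ge0 => i _.
  exact: total_moment_ge0.
rewrite -coefE /total_moment ge0_sume_distrr; last by move=> c _; exact: moment_ge0.
by apply: lee_sum => c _; apply: lee_wpmul2r => //; exact: moment_ge0.
Qed.

End moments.

(** * Submultiplicative sequences and holding times *)

(** A submultiplicative summable sequence decays exponentially, because one of
    its terms is at most one half. *)
Lemma submul_summable_exp (R : realType) (a : nat -> R) (M : R) :
    (forall k, 0 <= a k) -> (forall k l, a (k + l)%N <= a k * a l) ->
    (forall K, \sum_(k < K) a k <= M) ->
  exists C b : R, [/\ 0 < C, 0 < b & forall k, a k <= C * expR (- b * k%:R)].
Proof.
move=> a0 aM sumM.
have aleM k : a k <= M.
  by rewrite (le_trans _ (sumM k.+1))// big_ord_recr/= lerDr sumr_ge0.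
have M0 : 0 <= M := le_trans (a0 0%N) (aleM 0%N).
have [p [p0 ap]] : exists p, (0 < p)%N /\ a p <= 2^-1.
  apply: contrapT => np.
  have ap q : 2^-1 <= a q.+1.
    by rewrite leNgt; apply/negP => aq; apply: np; exists q.+1; split => //; exact: ltW.
  pose K := Num.bound (2 * M).
  have := sumM K.+1; rewrite leNgt => /negP; apply.
  rewrite big_ord_recl/=.
  have KM : 2 * M < K%:R by apply: archi_boundP; rewrite mulr_ge0.
  have : \sum_(i < K) (2^-1 : R) <= \sum_(i < K) a (bump 0 i) by apply: ler_sum.
  rewrite sumr_const card_ord -mulr_natl.
  have := a0 0%N; lra.
have pow q r : a (q * p + r)%N <= 2^-1 ^+ q * M.
  elim: q => [|q IH]; first by rewrite mul0n add0n expr0 mul1r.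
  rewrite mulSn -addnA (le_trans (aM _ _))// exprS -mulrA.
  by apply: ler_pM.
exists (2 * M + 1), (ln 2 / p%:R); split => [||k].
- by rewrite ltr_wpDl// mulr_ge0.
- by rewrite divr_gt0 ?ltr0n// ln_gt0// ltr1n.
have e2 : expR (- ln 2) = 2^-1 :> R by rewrite expRN lnK// posrE.
have step : 2^-1 ^+ (k %/ p).+1 <= expR (- (ln 2 / p%:R) * k%:R) :> R.
  rewrite -e2 -expRM_natl ler_expR mulrN mulNr lerN2 mulrAC -mulrA mulrC.
  rewrite ler_pM2r ?ln_gt0 ?ltr1n// ler_pdivrMr ?ltr0n// -natrM ler_nat.
  by rewrite ltnW// ltn_ceil.
have -> : a k = a (k %/ p * p + k %% p)%N by rewrite -divn_eq.
apply: (le_trans (pow _ _)).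
have E : 2^-1 ^+ (k %/ p) = 2 * 2^-1 ^+ (k %/ p).+1 :> R.
  by rewrite exprS mulrA divff ?mul1r.
rewrite E mulrAC.
by apply: ler_pM; rewrite ?mulr_ge0 ?exprn_ge0 ?invr_ge0 ?lerDl.
Qed.

Lemma measurable_discount (R : realType) d (T : measurableType d) (f : T -> R) :
  measurable_fun setT f -> measurable_fun setT (fun w => expR (- f w)).
Proof.
move=> mf; apply: (measurableT_comp (@measurable_expR R)).
exact: (measurableT_comp (@oppr_measurable R setT) mf).
Qed.

Section holding_times.
Context (R : realType) (d : measure_display) (Omega : measurableType d)
  (N n : nat) (P : 'I_N -> probability Omega R)
  (S : 'I_N -> jump_process Omega R N n).
Hypothesis hS : semi_markov_jump_system P S.
Hypothesis hold_gt0 : forall i0, {ae P i0, forall w k, 0 < hold (S i0) k w}.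

Let jS i0 : is_jump_process (S i0) i0.
Proof. by case: hS => Q /(_ i0)[]. Qed.

(** Holding times are positive and there are finitely many modes. *)
Lemma hold_ge_uniform : exists2 dl : R, 0 < dl &
  forall i, (2^-1%:E <= P i [set w | (dl <= hold (S i) 0 w)%R])%E.
Proof.
pose F i (q : nat) := [set w | (q.+1%:R^-1 <= hold (S i) 0 w)%R].
have mF i q : measurable (F i q).
  rewrite (_ : F i q = hold (S i) 0 @^-1` `[q.+1%:R^-1, +oo[%classic).
    rewrite -[_ @^-1` _]setTI.
    exact: measurable_hold (jS i) measurableT _ (measurable_itv _).
  by apply/seteqP; split=> w /=; rewrite in_itv/= andbT.
have mUF i : measurable (\bigcup_q F i q) by exact: bigcupT_measurable.
have PF1 i : P i (\bigcup_q F i q) = 1%E.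
  apply/eqP; rewrite -(probability_setT (P i)) -(setvU (\bigcup_q F i q)) .
  rewrite measureU//; last 2 first.
    exact: measurableC.
    exact: setICl.
  rewrite [X in (X + _)%E](_ : _ = 0%E) ?add0e//.
  have [Z [mZ Z0 subZ]] := hold_gt0 i.
  apply: (subset_measure0 _ mZ _ Z0); first exact: measurableC.
  apply: subset_trans subZ => w /= nF h0; apply: nF.
  have h := h0 0%N; exists (Num.bound (hold (S i) 0 w)^-1) => //=.
  rewrite /F/= invf_ple ?posrE// (le_trans (ltW (archi_boundP _)))//.
    by rewrite invr_ge0 ltW.
  by rewrite ler_nat.
have cvgF i : P i (F i q) @[q --> \oo] --> 1%E.
  rewrite -(PF1 i); apply: nondecreasing_cvg_mu => //.
  move=> q q' qq'; apply/subsetPset => w /=; rewrite /F/= => /(le_trans _); apply.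
  by rewrite lef_pV2 ?posrE// ler_nat.
have nearF i : \forall q \near \oo, (2^-1%:E <= P i (F i q))%E.
  have /fine_cvgP[_ cF] := cvgF i.
  have half : (2^-1 : R) < 1 by lra.
  near=> q; rewrite -[leRHS]fineK ?fin_num_measure// lee_fin ltW//.
  by near: q; exact: (cvgr_gt _ cF).
have [q Fq] : exists q, forall i, (2^-1%:E <= P i (F i q))%E.
  have : \forall q \near \oo, forall i, (2^-1%:E <= P i (F i q))%E.
    by apply: filter_forall => i; exact: nearF.
  by move/filter_ex.
by exists q.+1%:R^-1.
Unshelve. all: by end_near. Qed.

Lemma mean_discount_lt1 : exists2 rho : R, 0 <= rho < 1 &
  forall i, (\int[P i]_w (expR (- hold (S i) 0 w))%:E <= rho%:E)%E.
Proof.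
have [dl dl0 hdl] := hold_ge_uniform.
have e1 : expR (- dl) < 1 by rewrite -expR0 ltr_expR oppr_lt0.
exists ((1 + expR (- dl)) / 2).
  by have := expR_gt0 (- dl); lra.
move=> i; pose G := [set w | (dl <= hold (S i) 0 w)%R].
have mh := measurable_hold 0 (jS i).
have mG : measurable G.
  rewrite (_ : G = hold (S i) 0 @^-1` `[dl, +oo[%classic).
    by rewrite -[_ @^-1` _]setTI; exact: mh.
  by apply/seteqP; split=> w /=; rewrite in_itv/= andbT.
pose p := fine (P i G).
have PG : P i G = p%:E by rewrite fineK// fin_num_measure.
have p2 : 2^-1 <= p by rewrite -lee_fin -PG; exact: hdl.
apply: (@le_trans _ _ (\int[P i]_w (expR (- dl) * \1_G w + \1_(~` G) w)%:E)%E).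
  apply: ae_ge0_le_integral => //.
  - by apply/measurable_EFinP; exact: (measurable_discount mh).
  - apply/measurable_EFinP; apply: measurable_funD; last first.
      by apply: measurable_indic; exact: measurableC.
    by apply: measurable_funM => //; exact: measurable_indic.
  apply: filterS (hold_gt0 i) => w h0 _; rewrite lee_fin !indicE in_setC.
  case: (boolP (w \in G)) => [|_] /=.
    by rewrite inE /G/= addr0 mulr1 ler_expR lerN2.
  by rewrite mulr0 add0r -expR0 ler_expR lerNl oppr0 ltW.
under eq_integral do rewrite EFinD EFinM.
have mG1 : measurable_fun setT (\1_G : Omega -> R) by exact: measurable_indic.
have mGC : measurable_fun setT (\1_(~` G) : Omega -> R).
  by apply: measurable_indic; exact: measurableC.
rewrite ge0_integralD//; last 2 first.
- by apply: emeasurable_funM => //; exact/measurable_EFinP.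
- exact/measurable_EFinP.
rewrite ge0_integralZl_EFin ?expR_ge0//; last exact/measurable_EFinP.
rewrite !integral_indic//; last exact: measurableC.
have PGC : P i (~` G) = (1 - p)%:E by rewrite probability_setC// PG.
rewrite !setIT [X in (_ * X + _)%E](_ : _ = p%:E); last exact: PG.
rewrite [X in (_ + X)%E](_ : _ = (1 - p)%:E); last exact: PGC.
rewrite -EFinM -EFinD lee_fin.
by nra.
Qed.

(** The next holding time is independent of the past given the mode, so that the
    expectation of [expR (- time (S i0) k w)] decays geometrically in [k]: the
    switching times cannot accumulate. *)
Lemma time_unbounded i0 : {ae P i0, forall w u, exists k, u < time (S i0) k w}.
Proof.
have [rho /andP[rho0 rho1] hrho] := mean_discount_lt1.
have mt k : measurable_fun setT (time (S i0) k) by case: (jS i0).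
have mexp k : measurable_fun setT (fun w => expR (- time (S i0) k w)).
  exact: (measurable_discount (mt k)).
pose E k := (\int[P i0]_w (expR (- time (S i0) k w))%:E)%E.
have Ele k : (E k <= (rho ^+ k)%:E)%E.
  elim: k => [|k IH].
    rewrite /E; under eq_integral => w _.
      have -> : time (S i0) 0 w = 0 by case: (jS i0) => _ _ _ _ /(_ w)[].
      rewrite oppr0 expR0; over.
    by rewrite integral_cst//= mul1e probability_setT expr0.
  apply: (@le_trans _ _ (rho%:E * E k)%E); last first.
    by rewrite exprS EFinM lee_wpmul2l.
  rewrite /E.
  rewrite (@ge0_integral_mode _ _ _ _ _ (P i0) (S i0) i0 k)//.
  rewrite (@ge0_integral_mode _ _ _ _ _ (P i0) (S i0) i0 k _
    (fun w => expR (- time (S i0) k w)))//.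
  rewrite ge0_sume_distrr; last by move=> i _; apply: integral_ge0.
  apply: lee_sum => i _; rewrite setTI.
  under eq_integral => w _.
    have -> : expR (- time (S i0) k.+1 w) = expR (- time (S i0) k w) *
       (fun z : R * borel_mxType R n => expR (- z.1)) (step_data (S i0) k w).
      by rewrite -expRD/= /hold; congr expR; ring.
    over.
  rewrite (@system_step _ _ _ _ _ P S hS i0 i k (fun w => expR (- time (S i0) k w))
     (fun z => expR (- z.1)))//.
  - rewrite muleC; apply: lee_wpmul2r; last exact: hrho.
    by apply: integral_ge0 => w _; rewrite lee_fin expR_ge0.
  - have mtk := @measurable_time_history _ _ _ _ _ (S i0) k k (leqnn k).
    exact: (measurable_discount mtk).
  - exact: (measurable_discount measurable_fst).
pose D (u : nat) := \bigcap_k [set w | time (S i0) k w <= u%:R].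
have mD u : measurable (D u).
  apply: bigcapT_measurable => k.
  rewrite (_ : [set w | _] = time (S i0) k @^-1` `]-oo, u%:R]%classic).
    by rewrite -[_ @^-1` _]setTI; exact: mt.
  by apply/seteqP; split=> w /=; rewrite in_itv.
have D0 u : P i0 (D u) = 0%E.
  pose c : R := expR (- u%:R).
  have c0 : 0 < c by exact: expR_gt0.
  have bnd k : (c%:E * P i0 (D u) <= (rho ^+ k)%:E)%E.
    apply: le_trans (Ele k).
    rewrite -[D u]setIT -integral_indic// -ge0_integralZl_EFin ?(ltW c0)//; last first.
      by apply/measurable_EFinP; exact: measurable_indic.
    apply: ge0_le_integral => //.
    - by move=> w _; rewrite mule_ge0 ?lee_fin ?(ltW c0).
    - by apply/measurable_EFinP; apply: measurable_funM => //; exact: measurable_indic.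
    - exact/measurable_EFinP.
    move=> w _; rewrite -EFinM lee_fin indicE.
    case: (boolP (w \in D u)) => [|_]; last by rewrite mulr0 expR_ge0.
    by rewrite inE mulr1 => /(_ k Logic.I)/= tu; rewrite ler_expR lerN2.
  pose p := fine (P i0 (D u)).
  have Pp : P i0 (D u) = p%:E by rewrite fineK// fin_num_measure.
  have p0 : 0 <= p by rewrite fine_ge0.
  rewrite Pp; congr (_%:E); apply/eqP; rewrite eq_le p0 andbT.
  have cvg0 : rho ^+ k @[k --> \oo] --> 0 by apply: cvg_expr; rewrite ger0_norm.
  have : c * p <= 0.
    rewrite -(cvg_lim (@Rhausdorff R) cvg0); apply: limr_ge.
      by apply/cvg_ex; exists 0.
    by near=> k; have := bnd k; rewrite Pp -EFinM lee_fin.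
  by rewrite pmulr_rle0.
have : {ae P i0, forall w u, ~ D u w}.
  apply/ae_foralln => u; exists (D u).
  by split; [exact: mD|exact: D0|move=> w /= nDw; exact: contrapT].
apply: filterS => w nD u.
have [k /negP tk] : exists k, ~ time (S i0) k w <= (Num.bound `|u|)%:R.
  by apply/existsNP => tu; apply: (nD (Num.bound `|u|)) => k _ /=; exact: tu.
exists k; rewrite -ltNge in tk; apply: le_lt_trans tk.
exact: le_trans (ler_norm u) (ltW (archi_boundP (normr_ge0 u))).
Unshelve. all: by end_near. Qed.



End holding_times.

(** * Equivalence of the two stabilities *)

Section switching_intervals.
Context (R : realType).
Implicit Types (t F : nat -> R).

Lemma exists_active_interval t (u : R) : t 0%N <= u -> (exists k, u < t k) ->
  exists k, t k <= u < t k.+1.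
Proof.
move=> t0u ut; have [k utk kmin] := ex_minnP ut.
case: k utk kmin => [|k] utk kmin; first by rewrite ltNge t0u in utk.
exists k; rewrite utk andbT leNgt; apply/negP => /kmin.
by rewrite ltnn.
Qed.

(** At most one of the intervals [[t k, t k.+1[] contains [u]. *)
Lemma sum_active_le t F (B u : R) K :
    (forall k, t k <= t k.+1) -> 0 <= B ->
    (forall k, t k <= u < t k.+1 -> F k <= B) ->
  \sum_(k < K) F k * (t k <= u < t k.+1)%R%:R <= B.
Proof.
move=> tmono B0 FB.
have tle k l : (k <= l)%N -> t k <= t l.
  move=> /subnK <-; elim: (l - k)%N => // i IH.
  by rewrite addSn (le_trans IH).
elim: K => [|K IH]; first by rewrite big_ord0.
rewrite big_ord_recr/=; case: (boolP (_ <= _ < _)) => [/[dup] uK /andP[tu _]|_].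
  rewrite big1 ?add0r ?mulr1; first exact: FB.
  by move=> i _; rewrite [u < _]ltNge (le_trans (tle _ _ (ltn_ord i)) tu) andbF mulr0.
by rewrite mulr0 addr0.
Qed.

Lemma exists_grid_point (t0 t1 dl : R) : 0 < dl -> 0 <= t0 -> t0 + dl <= t1 ->
  exists q : nat, t0 <= q%:R * dl < t1.
Proof.
move=> dl0 t00 t01.
have ex : exists q : nat, t0 <= q%:R * dl.
  exists (Num.bound (t0 / dl)); rewrite -ler_pdivrMr//.
  by apply/ltW/archi_boundP; rewrite divr_ge0// ltW.
have [q tq qmin] := ex_minnP ex; exists q; rewrite tq/=.
case: q tq qmin => [|q] tq qmin.
  by rewrite mul0r (lt_le_trans _ t01)// ltr_wpDl.
have : q%:R * dl < t0 by rewrite ltNge; apply/negP => /qmin; rewrite ltnn.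
move=> h; apply: lt_le_trans t01.
by rewrite -natr1 mulrDl mul1r ltrD2r.
Qed.

Lemma sum_geometric_le (z : R) K : 0 <= z < 1 ->
  \sum_(k < K) z ^+ k <= (1 - z)^-1.
Proof.
move=> /andP[z0 z1]; rewrite -[leRHS]mul1r ler_pdivlMr ?subr_gt0//.
have := subrX1 z K; have := exprn_ge0 K z0; nra.
Qed.

End switching_intervals.

Lemma measurable_mx_norm (R : realType) d (T : measurableType d) (p : nat)
    (v : T -> 'cV[R]_p) :
  (forall a, measurable_fun setT (fun w => v w a 0)) ->
  measurable_fun setT (fun w => `|v w|).
Proof.
move=> mv.
have -> : (fun w => `|v w|) =
    (fun w => \big[Num.max/0]_(ij : 'I_p * 'I_1) `|v w ij.1 ij.2|).
  by apply/funext => w; rewrite [LHS]/Num.Def.normr/= mx_normrE.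
elim: (index_enum _) => [|[i j] s IH].
  by under eq_fun do rewrite big_nil; exact: measurable_cst.
rewrite (ord1 j) {j}; under eq_fun do rewrite big_cons/=.
apply: measurable_maxr => //.
exact: (measurableT_comp (@normr_measurable _ _) (mv i)).
Qed.

Section equivalence.
Context (R : realType) (d : measure_display)
    (Omega : measurableType d) (N n : nat)
    (P : 'I_N -> probability Omega R) (A : 'I_N -> 'M[R]_n)
    (S : 'I_N -> jump_process Omega R N n)
    (x : 'I_N -> 'cV[R]_n -> R -> Omega -> 'cV[R]_n)
    (Tmax : R) (m : nat).
Hypothesis hS : semi_markov_jump_system P S.
Hypothesis hx : forall (i0 : 'I_N) (x0 : 'cV[R]_n),
        {ae P i0, forall w, is_trajectory A
           (fun k => mode (S i0) k w) (fun k => time (S i0) k w)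
           (fun k => jump (S i0) k w) x0 (fun t => x i0 x0 t w)}.
Hypothesis hT : 0 < Tmax.
Hypothesis hhold : forall (i0 : 'I_N) (k : nat),
        {ae P i0, forall w, 0 < hold (S i0) k w <= Tmax}.

Let jS i0 : is_jump_process (S i0) i0.
Proof. by case: hS => Q /(_ i0)[]. Qed.

Let hold_gt0 i0 : {ae P i0, forall w k, 0 < hold (S i0) k w}.
Proof.
by apply/ae_foralln => k; apply: filterS (hhold i0 k) => w /andP[].
Qed.

Let X i0 (x0 : 'cV[R]_n) k w := discretization A (S i0) x0 k w.

Let growth : R := n%:R * \sum_i expR (n%:R * `|A i| * Tmax).

Let growth_ge0 : 0 <= growth.
Proof. by rewrite mulr_ge0// sumr_ge0// => i _; exact: expR_ge0. Qed.

Let expmx_growth i u (v : 'cV[R]_n) : `|u| <= Tmax ->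
  `|expmx (u *: A i) *m v| <= growth * `|v|.
Proof.
move=> uT; apply: (le_trans (mulmx_norm_le _ _)); rewrite ler_wpM2r//.
rewrite ler_wpM2l// (le_trans (expmx_norm_bound (A i) uT))//.
by rewrite (bigD1 i)//= lerDl sumr_ge0// => j _; exact: expR_ge0.
Qed.

(** A switching interval lasts at most [Tmax], on which the flow and its inverse
    are bounded by [growth]. *)
Let ae_sandwich i0 x0 : {ae P i0, forall w, forall k u,
   time (S i0) k w <= u < time (S i0) k.+1 w ->
   `|x i0 x0 u w| <= growth * `|X i0 x0 k w| /\
   `|X i0 x0 k w| <= growth * `|x i0 x0 u w|}.
Proof.
have hh : {ae P i0, forall w k, 0 < hold (S i0) k w <= Tmax}.
  exact: (ae_foralln (hhold i0)).
apply: filterS2 (hx i0 x0) hh => w tr h k u uk.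
have t0 : time (S i0) 0 w = 0 by case: (jS i0) => _ _ _ _ /(_ w)[].
have h0 l : 0 < hold (S i0) l w by case/andP: (h l).
have uT : `|u - time (S i0) k w| <= Tmax.
  case/andP: uk => u1 u2; rewrite ger0_norm ?subr_ge0//.
  by case/andP: (h k) => _ /(le_trans _); apply; rewrite /hold lerD2r; exact: ltW.
have xE := trajectoryE tr t0 h0 uk; rewrite -/(X i0 x0 k w) in xE.
split; first by rewrite xE; exact: expmx_growth.
have -> : X i0 x0 k w =
    expmx (- (u - time (S i0) k w) *: A (mode (S i0) k w)) *m x i0 x0 u w.
  by rewrite xE mulmxA -{2}[u - _]opprK expmx_mulN mul1mx.
by apply: expmx_growth; rewrite normrN.
Qed.

Let ae_time_le i0 : {ae P i0, forall w k, time (S i0) k w <= k%:R * Tmax}.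
Proof.
have hh : {ae P i0, forall w k, 0 < hold (S i0) k w <= Tmax}.
  exact: (ae_foralln (hhold i0)).
apply: filterS hh => w h; elim=> [|k IH].
  by case: (jS i0) => _ _ _ _ /(_ w)[-> _]; rewrite mul0r.
rewrite -(subrK (time (S i0) k w) (time (S i0) k.+1 w)) -/(hold (S i0) k w).
by rewrite -natr1 mulrDl mul1r addrC lerD//; case/andP: (h k).
Qed.

(** A switching interval that contains [t] has an index [k] with [t < k.+1 * Tmax],
    so that the moment at time [t] is bounded by a tail of a geometric series. *)
Lemma discrete_stable_stable :
  discrete_exp_mean_stable P (fun i0 => discretization A (S i0)) m ->
  exp_mean_stable P x m.
Proof.
move=> [C [b [C0 b0 hC]]].
pose z := expR (- b).
have z01 : 0 <= z < 1 by rewrite expR_ge0 /z -expR0 ltr_expR oppr_lt0.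
pose c := growth ^+ m.
have c0 : 0 <= c by rewrite exprn_ge0.
have z1 : 0 < (1 - z)^-1 by rewrite invr_gt0 subr_gt0; case/andP: z01.
exists (c * C * expR b * (1 - z)^-1 + 1), (b / Tmax); split.
- by rewrite ltr_wpDl// !mulr_ge0 ?expR_ge0 // ltW.
- by rewrite divr_gt0.
move=> i0 x0 t t0; rewrite expectation.unlock.
pose k0 := Num.trunc (t / Tmax).
have mXm k : measurable_fun setT (fun w => `|X i0 x0 k w| ^+ m).
  apply: measurable_funX; apply: measurable_mx_norm => a.
  exact: measurable_discretization (jS i0).
pose f k w : \bar R := (c * `|X i0 x0 (k0 + k) w| ^+ m)%:E.
have f0 k w : (0 <= f k w)%E by rewrite lee_fin mulr_ge0// exprn_ge0.
have mf k : measurable_fun setT (f k).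
  by apply/measurable_EFinP; apply: measurable_funM.
apply: (@le_trans _ _ (\int[P i0]_w (\sum_(0 <= k <oo) f k w))%E).
  apply: ae_ge0_le_integral_nonmeas.
  - by move=> w; rewrite lee_fin exprn_ge0.
  - by move=> w; apply: nneseries_ge0.
  apply: filterS3 (ae_sandwich i0 x0) (ae_time_le i0)
    (time_unbounded hS hold_gt0 i0) => w sw tl unb.
  have time0 : time (S i0) 0 w = 0 by case: (jS i0) => _ _ _ _ /(_ w)[].
  have [|k tk] := @exists_active_interval _ (time (S i0) ^~ w) t _ (unb t).
    by rewrite time0.
  have k0k : (k0 <= k)%N.
    rewrite truncn_le_nat ltr_pdivrMr//; case/andP: tk => _ /lt_le_trans; apply.
    exact: tl.
  apply: (@le_trans _ _ (f (k - k0)%N w)).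
    rewrite lee_fin subnKC// -exprMn lerXn2r ?nnegrE ?(mulr_ge0 growth_ge0)//.
    by case: (sw k t tk).
  apply: le_trans (nneseries_lim_ge (k - k0).+1 _); last by [].
  by rewrite big_nat_recr//= leeDr// sume_ge0.
rewrite integral_nneseries//.
have Ef k : (\int[P i0]_w f k w <=
    (c * C * z ^+ k0 * `|x0| ^+ m * z ^+ k)%:E)%E.
  rewrite /f; under eq_integral do rewrite EFinM.
  rewrite ge0_integralZl_EFin//; last exact/measurable_EFinP.
  have -> : c * C * z ^+ k0 * `|x0| ^+ m * z ^+ k =
      c * (C * expR (- b * (k0 + k)%:R) * `|x0| ^+ m).
    by rewrite expRM_natr exprD -/z; ring.
  rewrite EFinM lee_wpmul2l//.
  by have := hC i0 x0 (k0 + k)%N; rewrite expectation.unlock.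
apply: lime_le.
  by apply: is_cvg_nneseries => k _ _; apply: integral_ge0 => w _.
near=> K; apply: (@le_trans _ _
  (\sum_(0 <= k < K) (c * C * z ^+ k0 * `|x0| ^+ m * z ^+ k)%:E)%E).
  by apply: lee_sum => k _; exact: Ef.
rewrite sumEFin lee_fin -mulr_sumr big_mkord.
have E0 : 0 <= c * C * z ^+ k0 * `|x0| ^+ m.
  by rewrite !mulr_ge0 ?exprn_ge0 ?(ltW C0)//; case/andP: z01.
apply: (le_trans (ler_wpM2l E0 (sum_geometric_le K z01))).
have zk : z ^+ k0 <= expR b * expR (- (b / Tmax) * t).
  rewrite /z -expRM_natr -expRD ler_expR.
  have := truncnS_gt (t / Tmax); rewrite -/k0 -natr1 => h.
  have -> : b + - (b / Tmax) * t = b * (1 - t / Tmax) by ring.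
  rewrite mulNr -mulrN ler_pM2l//; lra.
have -> : (c * C * expR b * (1 - z)^-1 + 1) * expR (- (b / Tmax) * t) * `|x0| ^+ m =
  c * C * (expR b * expR (- (b / Tmax) * t)) * `|x0| ^+ m * (1 - z)^-1 +
  expR (- (b / Tmax) * t) * `|x0| ^+ m by ring.
apply: ler_wpDr; first by rewrite mulr_ge0 ?expR_ge0 ?exprn_ge0.
rewrite ler_wpM2r ?(ltW z1)// ler_wpM2r ?exprn_ge0// ler_wpM2l//.
by rewrite mulr_ge0// ltW.
Unshelve. all: by end_near. Qed.

Hypothesis hpos : positive_system P A S.

Let weight i0 k w : R := (\sum_a `|X i0 (const_mx 1) k w a 0|) ^+ m.

Let weight_ge0 i0 k w : 0 <= weight i0 k w.
Proof. by rewrite exprn_ge0// sumr_ge0. Qed.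

Let measurable_weight_history i0 k :
  @measurable_fun _ _ (historyType (S i0) k) R setT (weight i0 k).
Proof.
apply: measurable_funX; apply: measurable_sum => a.
apply: (@measurableT_comp _ _ _ (historyType (S i0) k) R R).
  exact: normr_measurable.
exact: measurable_discretization_history.
Qed.

Let measurable_weight i0 k : measurable_fun setT (weight i0 k).
Proof. exact: (@measurable_history _ _ _ _ _ (S i0) i0 k). Qed.

(** Given the mode, the holding time is independent of the current state. *)
Let total_moment_long_hold dl i0 k :
  (forall i, (2^-1%:E <= P i [set w | (dl <= hold (S i) 0 w)%R])%E) ->
  (2^-1%:E * total_moment P A S m k i0 <=
   \int[P i0]_w (weight i0 k w * (dl <= hold (S i0) k w)%R%:R)%:E)%E.
Proof.
move=> hdl.
pose G : set (R * borel_mxType R n) := fst @^-1` `[dl, +oo[%classic.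
have mG : measurable G.
  by rewrite -[G]setTI; apply: measurable_fst => //; exact: measurable_itv.
pose phi : R * borel_mxType R n -> R := \1_G.
have mphi : measurable_fun setT phi by exact: measurable_indic.
have phiE i l w : (dl <= hold (S i) l w)%R%:R = phi (step_data (S i) l w).
  rewrite /phi indicE; congr ((nat_of_bool _)%:R).
  by apply/idP/idP; rewrite inE /G/= in_itv/= andbT.
have mphik i l : measurable_fun setT (fun w => phi (step_data (S i) l w)).
  exact: (measurableT_comp mphi (measurable_step_data l (jS i))).
under [leRHS]eq_integral do rewrite phiE.
rewrite total_momentE//.
rewrite (@ge0_integral_mode _ _ _ _ _ (P i0) (S i0) i0 k)//; last 2 first.
- exact: measurable_weight.
- exact: weight_ge0.
rewrite [leRHS](@ge0_integral_mode _ _ _ _ _ (P i0) (S i0) i0 k)//; last 2 first.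
- exact: measurable_funM.
- by move=> w; rewrite mulr_ge0.
rewrite ge0_sume_distrr; last first.
  by move=> i _; apply: integral_ge0 => w _; rewrite lee_fin; exact: weight_ge0.
apply: lee_sum => i _; rewrite setTI.
rewrite (@system_step _ _ _ _ _ P S hS i0 i k (weight i0 k) phi)//.
rewrite muleC; apply: lee_wpmul2l.
  by apply: integral_ge0 => w _; rewrite lee_fin; exact: weight_ge0.
apply: (le_trans (hdl i)).
pose G' := [set w | (dl <= hold (S i) 0 w)%R].
have mG' : measurable G'.
  rewrite (_ : G' = step_data (S i) 0 @^-1` G).
    by rewrite -[_ @^-1` _]setTI; exact: (measurable_step_data 0 (jS i)).
  by apply/seteqP; split=> w /=; rewrite /G/= in_itv/= andbT.
rewrite -[X in (P i X <= _)%E]setIT -integral_indic//.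
apply: ge0_le_integral => //.
- exact/measurable_EFinP/measurable_indic.
- exact/measurable_EFinP.
move=> w _; rewrite lee_fin -phiE indicE.
by case: (boolP (w \in G')) => //; rewrite inE /G'/= => ->.
Qed.

Let ae_weight_le i0 : {ae P i0, forall w, forall k u,
  time (S i0) k w <= u < time (S i0) k.+1 w ->
  weight i0 k w <= (n%:R * growth) ^+ m * `|x i0 (const_mx 1) u w| ^+ m}.
Proof.
apply: filterS (ae_sandwich i0 (const_mx 1)) => w sw k u uk.
rewrite /weight -exprMn lerXn2r ?nnegrE ?sumr_ge0//.
  by rewrite (mulr_ge0 (mulr_ge0 _ growth_ge0)).
have [_ XE] := sw k u uk.
apply: (@le_trans _ _ (\sum_(a < n) `|X i0 (const_mx 1) k w|)).
  by apply: ler_sum => a _; exact: mx_entry_le_norm.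
by rewrite sumr_const card_ord -mulrA -[leLHS]mulr_natl ler_wpM2l.
Qed.

Let measurable_active i0 k u : measurable_fun setT
  (fun w => (time (S i0) k w <= u < time (S i0) k.+1 w)%R%:R : R).
Proof.
have [_ mt _ _ _] := jS i0.
pose G := time (S i0) k @^-1` `]-oo, u]%classic `&`
  time (S i0) k.+1 @^-1` `]u, +oo[%classic.
have mG : measurable G.
  by apply: measurableI; rewrite -[_ @^-1` _]setTI; exact: mt.
rewrite (_ : (fun _ => _) = \1_G); first exact: measurable_indic.
apply/funext => w; rewrite indicE; congr ((nat_of_bool _)%:R); apply/idP/idP.
  by move=> /andP[tu ut]; rewrite inE; split; rewrite /= in_itv/= ?andbT.
by rewrite inE => -[]; rewrite /= !in_itv/= andbT => -> ->.
Qed.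

(** A switching interval of length at least [dl] contains a multiple of [dl], and
    the expectations of the trajectory at these multiples are summable. Since
    intervals are that long with conditional probability at least one half, the
    total moments are summable as well. *)
Let total_moment_summable : exp_mean_stable P x m ->
  exists M : R, forall i0 K, (\sum_(k < K) total_moment P A S m k i0 <= M%:E)%E.
Proof.
move=> [C [b [C0 b0 hC]]].
have [dl dl0 hdl] := hold_ge_uniform hS hold_gt0.
pose z := expR (- b * dl).
have z01 : 0 <= z < 1.
  by rewrite expR_ge0 /z -expR0 ltr_expR mulNr oppr_lt0 mulr_gt0.
pose c := (n%:R * growth) ^+ m + 1.
have c0 : 0 < c by rewrite ltr_wpDl// exprn_ge0// mulr_ge0.
(* twice the geometric sum: long intervals have probability at least 1/2 *)
exists (2 * (c * C * (1 - z)^-1)) => i0 K.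
pose act k u w : R := (time (S i0) k w <= u < time (S i0) k.+1 w)%R%:R.
have act0 k u w : 0 <= act k u w by rewrite ler0n.
have mact k u : measurable_fun setT (fun w => weight i0 k w * act k u w).
  by apply: measurable_funM; [exact: measurable_weight|exact: measurable_active].
(* the first K intervals end before K * Tmax, hence meet only Q multiples of dl *)
pose Q := (Num.trunc (K%:R * Tmax / dl)).+1.
have grid u : 0 <= u ->
    (\int[P i0]_w (\sum_(k < K) weight i0 k w * act k u w)%:E <=
     (c * C * expR (- b * u))%:E)%E.
  move=> u0.
  have ci0 : 0 <= c^-1 by rewrite invr_ge0 ltW.
  have s0 w : 0 <= \sum_(k < K) weight i0 k w * act k u w.
    by apply: sumr_ge0 => k _; rewrite mulr_ge0.
  have ms : measurable_fun setT (fun w => \sum_(k < K) weight i0 k w * act k u w).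
    by apply: measurable_sum => k; exact: mact.
  have -> : (\int[P i0]_w (\sum_(k < K) weight i0 k w * act k u w)%:E =
     c%:E * \int[P i0]_w (c^-1 * \sum_(k < K) weight i0 k w * act k u w)%:E)%E.
    under [in RHS]eq_integral do rewrite EFinM.
    rewrite ge0_integralZl_EFin//; last 2 first.
    - by move=> w _; rewrite lee_fin.
    - exact/measurable_EFinP.
    by rewrite muleA -EFinM divff ?gt_eqF// mul1e.
  rewrite -mulrA EFinM lee_wpmul2l ?lee_fin ?(ltW c0)//.
  have := hC i0 (const_mx 1) u u0; rewrite expectation.unlock => hCu.
  apply: le_trans (le_trans hCu _); last first.
    rewrite lee_fin -[leRHS]mulr1 ler_wpM2l ?mulr_ge0 ?expR_ge0 ?(ltW C0)//.
    by rewrite exprn_ile1//; apply: mx_norm_le => // a j; rewrite mxE normr1.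
  apply: ae_ge0_le_integral_nonmeas.
  - by move=> w; rewrite lee_fin mulr_ge0.
  - by move=> w; rewrite lee_fin exprn_ge0.
  apply: filterS2 (ae_weight_le i0) (hold_gt0 i0) => w fle h0.
  rewrite lee_fin ler_pdivrMl//.
  apply: (@sum_active_le _ (time (S i0) ^~ w) (fun k => weight i0 k w)) => [k||k uk].
  - by have := h0 k; rewrite /hold subr_gt0 => /ltW.
  - by rewrite mulr_ge0 ?exprn_ge0// ltW.
  - apply: (le_trans (fle k u uk)).
    by rewrite ler_wpM2r ?exprn_ge0// /c lerDl.
apply: (@le_trans _ _ (2%:E * \sum_(k < K)
    \int[P i0]_w (weight i0 k w * (dl <= hold (S i0) k w)%R%:R)%:E)%E).
  rewrite ge0_sume_distrr; last first.
    by move=> k _; apply: integral_ge0 => w _; rewrite lee_fin mulr_ge0// ler0n.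
  apply: lee_sum => k _.
  have := lee_wpmul2l (ler0n R 2 : (0 <= 2%:E)%E) (total_moment_long_hold i0 k hdl).
  by rewrite muleA -EFinM divff// mul1e.
rewrite EFinM lee_wpmul2l//.
have mlong k : measurable_fun setT
    (fun w => weight i0 k w * (dl <= hold (S i0) k w)%R%:R).
  apply: measurable_funM => //.
  pose G := hold (S i0) k @^-1` `[dl, +oo[%classic.
  have mG : measurable G.
    by rewrite -[G]setTI; exact: (measurable_hold k (jS i0)).
  rewrite (_ : (fun _ => _) = \1_G); first exact: measurable_indic.
  apply/funext => w; rewrite indicE; congr ((nat_of_bool _)%:R); apply/idP/idP.
    by move=> h; rewrite inE /G/= in_itv/= andbT.
  by rewrite inE /G/= in_itv/= andbT.
rewrite -ge0_integral_sum//; last 2 first.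
- by move=> k; exact/measurable_EFinP.
- by move=> k w _; rewrite lee_fin mulr_ge0// ler0n.
apply: (@le_trans _ _ (\int[P i0]_w (\sum_(q < Q)
   (\sum_(k < K) weight i0 k w * act k (q%:R * dl) w)%:E))%E).
  apply: ae_ge0_le_integral_nonmeas.
  - by move=> w; apply: sume_ge0 => k _; rewrite lee_fin mulr_ge0// ler0n.
  - move=> w; apply: sume_ge0 => q _; rewrite lee_fin sumr_ge0// => k _.
    by rewrite mulr_ge0.
  apply: filterS2 (ae_time_le i0) (hold_gt0 i0) => w tle h0.
  rewrite !sumEFin lee_fin exchange_big/=; apply: ler_sum => k _.
  rewrite -mulr_sumr ler_wpM2l//.
  case: (boolP (dl <= _)) => [hk|_]; last exact: sumr_ge0.
  have tpos l : 0 <= time (S i0) l w.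
    elim: l => [|l IH]; first by case: (jS i0) => _ _ _ _ /(_ w)[-> _].
    by rewrite (le_trans IH)//; have := h0 l; rewrite /hold subr_gt0 => /ltW.
  have [|q qk] := exists_grid_point dl0 (tpos k) (t1 := time (S i0) k.+1 w).
    by rewrite addrC -lerBrDr.
  have qQ : (q < Q)%N.
    rewrite ltnS truncn_ge_nat; last first.
      by rewrite divr_ge0 ?(ltW dl0)// mulr_ge0 ?(ltW hT).
    rewrite ler_pdivlMr//; case/andP: qk => _ /ltW /le_trans; apply.
    by rewrite (le_trans (tle _))// ler_wpM2r ?(ltW hT)// ler_nat.
  by rewrite (bigD1 (Ordinal qQ))//= /act qk lerDl sumr_ge0.
rewrite ge0_integral_sum//; last 2 first.
- by move=> q; apply/measurable_EFinP; apply: measurable_sum => k; exact: mact.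
- move=> q w _; rewrite lee_fin sumr_ge0// => k _.
  by rewrite mulr_ge0.
apply: (@le_trans _ _ (\sum_(q < Q) (c * C * z ^+ q)%:E)%E).
  apply: lee_sum => q _; apply: (le_trans (grid _ _)).
    by rewrite mulr_ge0 ?(ltW dl0).
  by rewrite (_ : - b * (q%:R * dl) = - b * dl * q%:R) ?expRM_natr//; ring.
rewrite sumEFin lee_fin -mulr_sumr ler_wpM2l//; last exact: sum_geometric_le.
by rewrite mulr_ge0 ?(ltW c0) ?(ltW C0).
Qed.

(** The total moments are summable and submultiplicative, hence decay
    exponentially, and they dominate the moments from any initial state. *)
Lemma stable_discrete_stable : exp_mean_stable P x m ->
  discrete_exp_mean_stable P (fun i0 => discretization A (S i0)) m.
Proof.
move=> /total_moment_summable [M hM].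
pose T k i := total_moment P A S m k i.
have T0 k i : (0 <= T k i)%E by exact: total_moment_ge0.
have Tfin k i : T k i \is a fin_num.
  rewrite ge0_fin_numE//; apply: (@le_lt_trans _ _ M%:E); last exact: ltry.
  apply: le_trans (hM i k.+1); rewrite big_ord_recr/= leeDr//.
  by apply: sume_ge0 => l _; exact: T0.
pose a k := \sum_i fine (T k i).
have aE k : (a k)%:E = (\sum_i T k i)%E.
  by rewrite /a -sumEFin; apply: eq_bigr => i _; rewrite fineK.
have [|k l|K|C [b [C0 b0 aC]]] := @submul_summable_exp R a (N%:R * M).
- by move=> k; apply: sumr_ge0 => i _; exact: fine_ge0.
- rewrite -lee_fin EFinM !aE ge0_sume_distrl; last by move=> i _; exact: T0.
  apply: lee_sum => i _; rewrite muleC.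
  exact: (total_moment_submul hS hpos hold_gt0).
- rewrite -lee_fin -sumEFin; under eq_bigr do rewrite aE.
  rewrite exchange_big/=.
  apply: (@le_trans _ _ (\sum_(i < N) M%:E)%E).
    by apply: lee_sum => i _; exact: hM.
  by rewrite sumEFin lee_fin sumr_const card_ord mulr_natl.
exists C, b; split => // i0 x0 k; rewrite expectation.unlock.
apply: (@le_trans _ _ ((`|x0| ^+ m)%:E * T k i0)%E); last first.
  rewrite -[T k i0]fineK// -EFinM lee_fin mulrC ler_wpM2r ?exprn_ge0//.
  apply: le_trans (aC k).
  by rewrite /a (bigD1 i0)//= lerDl sumr_ge0// => i _; exact: fine_ge0.
rewrite /T total_momentE// -ge0_integralZl_EFin ?exprn_ge0//; last 2 first.
- by move=> w _; rewrite lee_fin; exact: weight_ge0.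
- by apply/measurable_EFinP; exact: measurable_weight.
apply: ae_ge0_le_integral_nonmeas.
- by move=> w; rewrite lee_fin exprn_ge0.
- by move=> w; rewrite -EFinM lee_fin mulr_ge0 ?exprn_ge0// sumr_ge0.
apply: filterS (discretization_dominated hpos hold_gt0 i0 x0) => w dom.
by rewrite -EFinM lee_fin -exprMn lerXn2r ?nnegrE ?mulr_ge0 ?sumr_ge0.
Qed.

End equivalence.

Theorem corollary4p8 (R : realType) (d : measure_display)
    (Omega : measurableType d) (N n : nat)
    (P : 'I_N -> probability Omega R) (A : 'I_N -> 'M[R]_n)
    (S : 'I_N -> jump_process Omega R N n)
    (x : 'I_N -> 'cV[R]_n -> R -> Omega -> 'cV[R]_n)
    (Tmax Rmax : R) (m : nat)
    (hS : semi_markov_jump_system P S)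
    (hpos : positive_system P A S)
    (hx : forall (i0 : 'I_N) (x0 : 'cV[R]_n),
        {ae P i0, forall w, is_trajectory A
           (fun k => mode (S i0) k w) (fun k => time (S i0) k w)
           (fun k => jump (S i0) k w) x0 (fun t => x i0 x0 t w)})
    (hT : 0 < Tmax) (hR : 0 < Rmax)
    (hhold : forall (i0 : 'I_N) (k : nat),
        {ae P i0, forall w, 0 < hold (S i0) k w <= Tmax})
    (hjump : forall (i0 : 'I_N) (k : nat),
        {ae P i0, forall w, `|jump (S i0) k w| <= Rmax})
    (hm : (0 < m)%N) :
  exp_mean_stable P x m <->
  discrete_exp_mean_stable P (fun i0 => discretization A (S i0)) m.
Proof.
split; first exact: (stable_discrete_stable hS hx hT hhold hpos).
exact: (discrete_stable_stable hS hx hT hhold).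
Qed.
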